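(* Let $S\subset\mathbb{N}^\times\setminus\{1\}$ be a family of pairwise relatively prime natural numbers and $P=\langle S\rangle\subset\mathbb{N}^\times$ the monoid generated by $S$, acting on $\mathbb{Z}$ by multiplication $\theta_p(m)=pm$. Every automorphism $\alpha$ of $\mathcal{Q}(\mathbb{Z}\rtimes P)$ with the property $\alpha(u)=u^*$ is outer. In particular, the automorphisms $\lambda_{-1}$ and $\phi$ of $\mathcal{Q}(\mathbb{Z}\rtimes P)$ given by $\lambda_{-1}(u)=u^*$, $\lambda_{-1}(s_p)=s_p$, and $\phi(u)=u^*$, $\phi(s_p)=u^{p-1}s_p$ for $p\in P$, are outer.
   Context: $\mathcal{Q}(\mathbb{Z}\rtimes P)$ is the universal $C^*$-algebra generated by a unitary $u$ and isometries $s_p$, $p\in P$, with $s_ps_q=s_{pq}$ and $s_1=1$, subject to (I) $s_pu^m=u^{pm}s_p$ for $m\in\mathbb{Z}$; (II) $s_p^*u^ms_q=u^{m_1}s_{p'}s_{q'}^*u^{m_2}$ if $m=pm_1+qm_2$ and $pP\cap qP=pp'P$, $pp'=qq'$, and $s_p^*u^ms_q=0$ if $m\notin p\mathbb{Z}+q\mathbb{Z}$; (III) $\sum_{m=0}^{p-1}u^ms_ps_p^*u^{-m}=1$ for all $p\in P$. An automorphism is outer if it is not of the form ${\rm Ad}(w)$ for a unitary $w$ in the algebra. *)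

(* Defs.v *)
From HB Require Import structures.
From mathcomp Require Import all_boot all_order all_algebra.
From mathcomp Require Import complex.
From mathcomp Require Import all_classical all_reals all_analysis.
Set Implicit Arguments.
Unset Strict Implicit.
Unset Printing Implicit Defensive.
Import Order.TTheory GRing.Theory Num.Theory.
Import numFieldNormedType.Exports.
Local Open Scope classical_set_scope.
Local Open Scope ring_scope.

(* Unital C*-algebras over the complex numbers R[i]. The norm of a normed module
   over R[i] takes its values in R[i]. The multiplication is given here instead of
   being inherited from a ring structure: Hierarchy-Builder has no join of (possibly
   zero) rings and normed modules below numDomainType. The ring structure is then
   derived as an instance below. *)
HB.mixin Record isCStarAlgebra (R : realType) A of CompleteNormedModule R[i] A := {
  cstar_one : A ;
  cstar_mul : A -> A -> A ;
  star : A -> A ;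
  cstar_mulA : associative cstar_mul ;
  cstar_mul1l : left_id cstar_one cstar_mul ;
  cstar_mul1r : right_id cstar_one cstar_mul ;
  cstar_mulDl : left_distributive cstar_mul +%R ;
  cstar_mulDr : right_distributive cstar_mul +%R ;
  cstar_mulZl : forall (a : R[i]) (x y : A),
    cstar_mul (a *: x) y = a *: cstar_mul x y ;
  cstar_mulZr : forall (a : R[i]) (x y : A),
    cstar_mul x (a *: y) = a *: cstar_mul x y ;
  cstar_normM : forall x y : A, `|cstar_mul x y| <= `|x| * `|y| ;
  starK : involutive star ;
  starD : {morph star : x y / x + y} ;
  starZ : forall (a : R[i]) (x : A), star (a *: x) = a^* *: star x ;
  starM : forall x y : A, star (cstar_mul x y) = cstar_mul (star y) (star x) ;
  cstar_norm : forall x : A, `|cstar_mul (star x) x| = `|x| ^+ 2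
}.

#[short(type="cstarType")]
HB.structure Definition CStarAlgebra (R : realType) :=
  {A of isCStarAlgebra R A & CompleteNormedModule R[i] A}.

Section CStarRing.
Variables (R : realType) (A : cstarType R).

Lemma cstar_mul0l : left_zero (0 : A) (@cstar_mul R A).
Proof.
move=> x; apply: (addrI (cstar_mul (0 : A) x)).
by rewrite -cstar_mulDl !addr0.
Qed.

Lemma cstar_mul0r : right_zero (0 : A) (@cstar_mul R A).
Proof.
move=> x; apply: (addrI (cstar_mul x (0 : A))).
by rewrite -cstar_mulDr !addr0.
Qed.

#[non_forgetful_inheritance]
HB.instance Definition _ := GRing.Nmodule_isPzSemiRing.Build (CStarAlgebra.sort A)
  (@cstar_mulA R A) (@cstar_mul1l R A) (@cstar_mul1r R A)
  (@cstar_mulDl R A) (@cstar_mulDr R A) cstar_mul0l cstar_mul0r.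

End CStarRing.

Section CStarNotions.
Variable R : realType.
Implicit Types A B : cstarType R.

Definition isometry_elt A (x : A) : Prop := star x * x = 1.

Definition unitary A (x : A) : Prop := star x * x = 1 /\ x * star x = 1.

(* u ^ m for a unitary u and m : int, using u^-1 = u^* *)
Definition upow A (u : A) (m : int) : A :=
  match m with
  | Posz n => u ^+ n
  | Negz n => star u ^+ n.+1
  end.

Definition star_morphism A B (f : A -> B) : Prop :=
  [/\ linear f, GRing.monoid_morphism f & forall x, f (star x) = star (f x)].

Definition star_automorphism A (f : A -> A) : Prop :=
  star_morphism f /\ bijective f.

Definition outer A (f : A -> A) : Prop :=
  ~ exists2 w : A, unitary w & forall x, f x = w * x * star w.

Definition closed_star_subalgebra A (X : set A) : Prop :=
  [/\ closed X,
      forall (a : R[i]) x y, X x -> X y -> X (a *: x + y),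
      forall x y, X x -> X y -> X (x * y)
    & forall x, X x -> X (star x)].

End CStarNotions.

Definition generated_submonoid (S : set nat) : set nat :=
  smallest [set M | M 1%N /\ forall m n, M m -> M n -> M (m * n)%N] S.

Definition right_ideal (P : set nat) (p : nat) : set nat :=
  [set (p * x)%N | x in P].

Section QRelations.
Variables (R : realType) (P : set nat).

(* Only the values s p with P p are relevant. *)
Definition Q_relations (A : cstarType R) (u : A) (s : nat -> A) : Prop :=
  [/\ [/\ unitary u,
          forall p, P p -> isometry_elt (s p),
          forall p q, P p -> P q -> s p * s q = s (p * q)%N
        & s 1%N = 1],
      forall p (m : int), P p -> s p * upow u m = upow u (p%:Z * m) * s p,
      (forall (p q p' q' : nat) (m m1 m2 : int), P p -> P q -> P p' -> P q' ->
         m = p%:Z * m1 + q%:Z * m2 ->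
         right_ideal P p `&` right_ideal P q = right_ideal P (p * p')%N ->
         (p * p' = q * q')%N ->
         star (s p) * upow u m * s q
         = upow u m1 * s p' * star (s q') * upow u m2),
      (forall (p q : nat) (m : int), P p -> P q ->
         ~ (exists m1 m2 : int, m = p%:Z * m1 + q%:Z * m2) ->
         star (s p) * upow u m * s q = 0)
    & forall p, P p ->
        \sum_(0 <= m < p)
          upow u m%:Z * s p * star (s p) * upow u (- m%:Z) = 1].

(* (A, u, s) is the universal C*-algebra Q(Z x| P) with its canonical
   generators. The morphism f is unique, since u and the s p generate A. *)
Definition is_Q (A : cstarType R) (u : A) (s : nat -> A) : Prop :=
  [/\ Q_relations u s,
      smallest [set X | closed_star_subalgebra X] ([set u] `|` s @` P) = setT
    & forall (B : cstarType R) (v : B) (t : nat -> B), Q_relations v t ->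
        exists f : A -> B, [/\ star_morphism f, f u = v
                             & forall p, P p -> f (s p) = t p]].

End QRelations.

(* Main.v *)
Require Import Defs.
From HB Require Import structures.
From mathcomp Require Import all_boot all_order all_algebra.
From mathcomp Require Import complex.
From mathcomp Require Import all_classical all_reals all_analysis.
From mathcomp Require Import ring lra zify.
Set Implicit Arguments.
Unset Strict Implicit.
Unset Printing Implicit Defensive.
Import Order.TTheory GRing.Theory Num.Theory.
Import numFieldNormedType.Exports.
Local Open Scope classical_set_scope.
Local Open Scope ring_scope.

(** The generators act on the Hilbert space of square-summable families indexed by
    the integers, [u] as the bilateral shift [e_n |-> e_(n+1)] and [s_p] as
    [e_n |-> e_(pn)] ([representation_relations]); universality turns this into a
    morphism [pi] from the algebra to the bounded operators. If an automorphism
    sending [u] to [u^*] were implemented by a unitary [w], then [W = pi w] would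
    satisfy [W U = U^* W], so that its entry at [(n, k - n)] would not depend on
    [n]. On the other hand every monomial in the generators and their adjoints moves
    [e_n] along lines of positive slope: for [n] large and positive it does not reach
    [e_(k-n)]. This persists for linear combinations and, up to a small error, for
    norm limits, because the operators with this support property form a
    star-subalgebra ([banded_mul]) and morphisms of C*-algebras are bounded. Hence
    all entries of [W] in the column of [e_0] vanish ([no_flip_near_banded]), which
    is absurd for an isometry.

    Boundedness of morphisms is obtained without spectral theory
    ([starm_selfadjoint_le1]): a self-adjoint [h] of norm at most [1/2] is the real
    part of the unitary [h + i sqrt (1 - h^2)], whose image is again unitary. The
    same bound shows that a morphism is determined by its values on the generators
    ([starm_eq_on_generators]), which gives uniqueness of the two automorphisms.

    Existence of [lambda] is universality applied to the pair of [u^*] and the [s_p]: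
    the defining relations are invariant under [u |-> u^*], the summation relation
    because the range projection of [u^m s_p] is periodic in [m]
    ([reflected_relations]). The automorphism [phi] is [lambda] followed by
    conjugation with [u^*], as [u^* s_p u = u^(p-1) s_p]. *)

(** * Norm and involution of a C*-algebra *)

Section CStarBasics.
Variables (R : realType) (A : cstarType R).
Implicit Types (x y z h : A) (a : R[i]).

Lemma cscaleAl a x y : (a *: x) * y = a *: (x * y).
Proof. exact: cstar_mulZl. Qed.

Lemma cscaleAr a x y : x * (a *: y) = a *: (x * y).
Proof. exact: cstar_mulZr. Qed.

Lemma cnormM x y : `|x * y| <= `|x| * `|y|.
Proof. exact: cstar_normM. Qed.

Lemma cstarM x y : star (x * y) = star y * star x.
Proof. exact: starM. Qed.

Lemma star0 : star 0 = 0 :> A.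
Proof. by apply: (addrI (star 0)); rewrite -starD !addr0. Qed.

Lemma starN x : star (- x) = - star x.
Proof. by apply: (addrI (star x)); rewrite -starD !subrr star0. Qed.

Lemma starB x y : star (x - y) = star x - star y.
Proof. by rewrite starD starN. Qed.

Lemma star1 : star 1 = 1 :> A.
Proof. by rewrite -[LHS]mul1r -[X in X * _](starK 1) -cstarM mul1r starK. Qed.

Lemma starX x n : star (x ^+ n) = star x ^+ n.
Proof.
elim: n => [|n IH]; first by rewrite !expr0 star1.
by rewrite exprS exprSr cstarM IH.
Qed.

Lemma norm_star x : `|star x| = `|x|.
Proof.
suff le y : `|y| <= `|star y|.
  by apply/eqP; rewrite eq_le le -{2}(starK x) le.
have [->|y0] := eqVneq y 0; first by rewrite normr0.
rewrite -(ler_pM2r (x := `|y|)) ?normr_gt0// -expr2 -cstar_norm.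
exact: cstar_normM.
Qed.

Lemma norm_one_le1 : `|1 : A| <= 1.
Proof.
have e : `|1 : A| = `|1 : A| ^+ 2.
  by rewrite -cstar_norm star1; congr `|_|; rewrite [RHS]mulr1.
have [->//|n0] := eqVneq (`|1 : A|) 0; rewrite le_eqVlt; apply/orP; left; apply/eqP.
by apply: (mulIf n0); rewrite -expr2 -e mul1r.
Qed.

Lemma norm_isometry_le1 x : star x * x = 1 -> `|x| <= 1.
Proof.
move=> xx; rewrite -(@expr_le1 _ 2)// -cstar_norm.
by have -> : cstar_mul (star x) x = 1 by []; exact: norm_one_le1.
Qed.

End CStarBasics.

(** * Convergence at a geometric rate *)

Section Halving.
Variable R : realType.

Lemma exp_half_lt_real (e : R) : 0 < e -> exists n, 2^-1 ^+ n < e.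
Proof.
move=> e0; have h1 : `|2^-1 : R| < 1 by rewrite ger0_norm ?invf_lt1 ?ltr1n.
have /cvgrPdist_lt/(_ e e0)[n _ /(_ n (leqnn n))] := cvg_expr h1.
by rewrite /= sub0r normrN ger0_norm ?exprn_ge0// => lt_e; exists n.
Qed.

Lemma exp_half_lt (e : R[i]) : 0 < e -> exists n, 2^-1 ^+ n < e.
Proof.
move=> e0; have er := RRe_real (gtr0_real e0).
have {e0}: 0 < complex.Re e by rewrite -ltcR er.
move: (complex.Re e) er => r <- /exp_half_lt_real[n lt_r]; exists n.
by rewrite -ltcR rmorphXn fmorphV rmorph_nat in lt_r.
Qed.

Lemma le_exp_half0 (c b : R[i]) : 0 <= b -> (forall n, b <= c * 2^-1 ^+ n) -> b = 0.
Proof.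
move=> b0 bc; have [//|bn0] := eqVneq b 0.
have bp : 0 < b by rewrite lt_def bn0.
have cp : 0 < c by have := lt_le_trans bp (bc 0%N); rewrite expr0 mulr1.
have [n] := exp_half_lt (divr_gt0 bp cp).
rewrite ltr_pdivlMr// mulrC => /lt_geF; by rewrite bc.
Qed.

End Halving.

(** A metric version of completeness, in which the geometric rate controls the
    distance of each term to the limit. It is needed both over the reals and over
    the complex numbers, hence the Archimedean hypothesis on the scalars. *)
Lemma cauchy_half_cvg (K : numFieldType) (V : completeNormedModType K)
    (z : nat -> V) (c : K) :
  (forall e : K, 0 < e -> exists n, 2^-1 ^+ n < e) ->
  (forall n m, `|z (n + m)%N - z n| <= c * 2^-1 ^+ n) ->
  exists l, forall n, `|l - z n| <= c * 2^-1 ^+ n.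
Proof.
move=> half_lt zc.
have c0 : 0 <= c by have := le_trans (normr_ge0 _) (zc 0%N 0%N); rewrite expr0 mulr1.
have cz : cvgn z.
  apply/cauchy_cvgP/cauchy_exP => e e0.
  have [c00|cn0] := eqVneq c 0.
    exists (z 0%N), 0%N => // m _; rewrite -ball_normE /= distrC.
    by have := zc 0%N m; rewrite add0n c00 mul0r => /le_lt_trans ->.
  have cp : 0 < c by rewrite lt_def cn0.
  have [n ltn] := half_lt _ (divr_gt0 e0 cp).
  exists (z n), n => // m /= nm; rewrite -ball_normE /= distrC.
  rewrite -(subnKC nm) (le_lt_trans (zc _ _))//.
  by rewrite mulrC -ltr_pdivlMr.
exists (limn z) => n; apply/ler_addgt0Pl => e e0.
have [m _ /(_ (n + m)%N (leq_addl _ _)) /= lim_m] := cvgr_dist_lt _ _ cz _ e0.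
by rewrite (le_trans (ler_distD (z (n + m)%N) _ _))// lerD// ltW.
Qed.


Lemma closed_of_approx (R : realType) (V : normedModType R[i]) (X : set V) :
  (forall x, (forall e : R[i], 0 < e -> exists2 y, X y & `|x - y| < e) -> X x) ->
  closed X.
Proof.
move=> apx x clx; apply: apx => e e0.
have /clx[y [Xy]] : nbhs x (ball x e) by exact: nbhsx_ballx.
by rewrite -ball_normE; exists y.
Qed.

(** * Square roots and boundedness of morphisms *)

Section SquareRoot.
Variables (R : realType) (A : cstarType R).
Implicit Types (x y z h : A) (a : R[i]).

Let step h z : A := 2^-1 *: (h * h + z * z).
Let root_seq h n : A := iter n (step h) 0.

Let norm_half : `|2^-1 : R[i]| = 2^-1.
Proof. by rewrite ger0_norm. Qed.

Let root_seq_bound h : `|h| <= 2^-1 -> forall n, `|root_seq h n| <= 2^-1.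
Proof.
move=> h2; elim=> [|n IH]; first by rewrite normr0.
rewrite /= normrZ norm_half -[leRHS]mulr1 ler_pM2l//.
rewrite (le_trans (ler_normD _ _))// [1]splitr.
have le_half x : `|x| <= 2^-1 -> `|x * x| <= 1 / 2.
  move=> x2; rewrite (le_trans (cnormM _ _))// mul1r -[leRHS]mulr1.
  by rewrite ler_pM// (le_trans x2)// invf_le1 ?ler1n.
by apply: lerD; exact: le_half.
Qed.

Let step_contract h z w : `|z| <= 2^-1 -> `|w| <= 2^-1 ->
  `|step h z - step h w| <= 2^-1 * `|z - w|.
Proof.
move=> z2 w2; rewrite /step -scalerBr normrZ norm_half ler_pM2l//.
have -> : h * h + z * z - (h * h + w * w) = z * (z - w) + (z - w) * w.
  by rewrite mulrBr mulrBl addrA subrK opprD addrACA subrr add0r.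
rewrite (le_trans (ler_normD _ _))// -[leRHS]mul1r [1]splitr mul1r [leRHS]mulrDl.
rewrite lerD// (le_trans (cnormM _ _))// ?ler_wpM2r//.
by rewrite mulrC ler_wpM2r.
Qed.

(** The square root of [1 - h^2] is [1 - z], where [z] solves the fixed point
    equation [z = (h^2 + z^2) / 2]; its right-hand side halves distances on the
    ball of radius [1/2]. *)
Lemma selfadjoint_sqrt h : star h = h -> `|h| <= 2^-1 ->
  exists y, [/\ star y = y, h * y = y * h & h * h + y * y = 1].
Proof.
move=> hh h2; pose z := root_seq h.
have zb n : `|z n| <= 2^-1 by exact: root_seq_bound.
have star_z n : star (z n) = z n.
  elim: n => [|n IH]; first exact: star0.
  have -> : z n.+1 = step h (z n) by [].
  by rewrite /step starZ starD !cstarM hh IH geC0_conj.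
have com_z n : h * z n = z n * h.
  elim: n => [|n IH]; first by rewrite mulr0 mul0r.
  have -> : z n.+1 = step h (z n) by [].
  rewrite /step cscaleAr cscaleAl mulrDr mulrDl -!mulrA; congr (_ *: (_ + _)).
  by rewrite -IH !mulrA IH.
have [l zl] : exists l, forall n, `|l - z n| <= 1 * 2^-1 ^+ n.
  apply: cauchy_half_cvg => [|n m]; first exact: exp_half_lt.
  rewrite mul1r.
  elim: n => [|n IH].
    rewrite expr0 add0n subr0 (le_trans (zb _))//.
    by rewrite invf_le1 ?ler1n.
  rewrite addSn exprS (le_trans (step_contract _ (zb _) (zb _)))//.
  by rewrite ler_pM2l.
have zl' n : `|z n - l| <= 2^-1 ^+ n by rewrite distrC (le_trans (zl n)) ?mul1r.
have lz' n : `|l - z n| <= 2^-1 ^+ n by rewrite distrC.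
have l_eq0 (x : A) (c : R[i]) : (forall n, `|x| <= c * 2^-1 ^+ n) -> x = 0.
  by move=> xc; apply/normr0_eq0/(le_exp_half0 _ xc).
have two (a : R[i]) : 2 * a = a + a by rewrite mulr2n mulrDl mul1r.
have star_l : star l = l.
  apply/subr0_eq/(l_eq0 _ 2) => n; rewrite -(subrKA (z n)) -{1}(star_z n) -starB.
  by rewrite (le_trans (ler_normD _ _))// norm_star two lerD.
have com_l : h * l = l * h.
  apply/subr0_eq/(l_eq0 _ 2) => n; rewrite -(subrKA (h * z n)) -mulrBr com_z -mulrBl.
  rewrite (le_trans (ler_normD _ _))// two lerD//.
    rewrite (le_trans (cnormM _ _))// -[leRHS]mul1r ler_pM//.
    by rewrite (le_trans h2)// invf_le1 ?ler1n.
  rewrite (le_trans (cnormM _ _))// -[leRHS]mulr1 ler_pM//.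
  by rewrite (le_trans h2)// invf_le1 ?ler1n.
have l2 : `|l| <= 2^-1.
  apply/ler_addgt0Pl => e e0; have [n ltn] := exp_half_lt e0.
  by rewrite -(subrK (z n) l) (le_trans (ler_normD _ _))// lerD// (le_trans _ (ltW ltn)).
have fix_l : l = step h l.
  apply/subr0_eq/(l_eq0 _ 2) => n; rewrite -(subrKA (z n.+1)).
  rewrite (le_trans (ler_normD _ _))// two lerD//.
    rewrite (le_trans (lz' n.+1))// exprS -[leRHS]mul1r ler_wpM2r ?exprn_ge0//.
    by rewrite invf_le1 ?ler1n.
  rewrite (le_trans (step_contract _ (zb _) l2))// -[leRHS]mul1r ler_pM//.
  by rewrite invf_le1 ?ler1n.
exists (1 - l); split.
- by rewrite starB star1 star_l.
- by rewrite mulrBr mulrBl mul1r mulr1 com_l.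
- have e : l + l = h * h + l * l.
    rewrite {1 2}fix_l -scalerDl -mulr2n -(mulr_natl 2^-1) mulfV ?scale1r//.
  have -> : (1 - l) * (1 - l) = 1 - (l + l) + l * l.
    by rewrite mulrBr mulr1 mulrBl mul1r opprB addrA addrAC opprD addrA.
  by rewrite addrCA -e subrK.
Qed.

End SquareRoot.

Section StarMorphisms.
Variables (R : realType) (A B : cstarType R) (f : A -> B).
Hypothesis f_morph : star_morphism f.
Let i_ : R[i] := 'i%C.

Lemma starmD : {morph f : x y / x + y}.
Proof.
by case: f_morph => lf _ _ x y; have := lf 1 x y; rewrite !scale1r.
Qed.

Lemma starm0 : f 0 = 0.
Proof. by apply: (addrI (f 0)); rewrite -starmD !addr0. Qed.

Lemma starmZ a : {morph f : x / a *: x}.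
Proof.
by case: f_morph => lf _ _ x; have := lf a x 0; rewrite starm0 !addr0.
Qed.

Lemma starmB : {morph f : x y / x - y}.
Proof. by move=> x y; rewrite -scaleN1r starmD starmZ scaleN1r. Qed.

Lemma starmM : {morph f : x y / x * y}.
Proof. by case: f_morph => _ []. Qed.

Lemma starm1 : f 1 = 1.
Proof. by case: f_morph => _ []. Qed.

Lemma starm_star : {morph f : x / star x}.
Proof. by case: f_morph. Qed.

(** If [h] is self-adjoint of norm at most [1/2] and [y^2 = 1 - h^2], then
    [h + i y] is unitary with self-adjoint part [h]; its image is unitary too, so
    the image of [h] has norm at most [1] whatever [f] is. *)
Lemma starm_selfadjoint_le1 h : star h = h -> `|h| <= 2^-1 -> `|f h| <= 1.
Proof.
move=> hh h2; have [y [yy com hy1]] := selfadjoint_sqrt hh h2.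
pose v := f h + i_ *: f y.
have sv : star v = f h - i_ *: f y.
  rewrite /v starD starZ -!starm_star hh yy.
  by rewrite (_ : i_^* = - i_) ?scaleNr// /i_; apply/eqP; rewrite eq_complex /= oppr0 !eqxx.
have vv : star v * v = 1.
  rewrite sv /v mulrDr !mulrBl !cscaleAr !cscaleAl scalerA -!starmM com.
  have -> : i_ * i_ = -1 by rewrite -expr2 sqr_i.
  by rewrite scaleN1r opprK addrA subrK -starmD hy1 starm1.
have v1 := norm_isometry_le1 vv.
have -> : f h = 2^-1 *: (v + star v).
  rewrite sv /v addrACA subrr addr0 -mulr2n -(scaler_nat 2 (f h)) scalerA.
  by rewrite mulVf ?scale1r// pnatr_eq0.
rewrite normrZ ger0_norm// ler_pdivrMl// mulr1 (le_trans (ler_normD _ _))//.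
by rewrite norm_star mulr2n lerD.
Qed.

(** The C*-identity reduces the estimate to the self-adjoint element [x^* x], which
    [c] rescales to norm [1/2]. *)
Lemma starm_norm_le x : `|f x| <= 2 * `|x|.
Proof.
have [->|x0] := eqVneq x 0; first by rewrite starm0 !normr0 mulr0.
have xp : 0 < `|x| by rewrite normr_gt0.
pose c : R[i] := 2^-1 * (`|x| ^+ 2)^-1.
have c0 : 0 < c by rewrite mulr_gt0 ?invr_gt0 ?exprn_gt0.
have : `|f (c *: (star x * x))| <= 1.
  apply: starm_selfadjoint_le1.
    by rewrite starZ cstarM starK geC0_conj// ltW.
  rewrite normrZ gtr0_norm// /c -cstar_norm -mulrA mulVf ?mulr1//.
  by rewrite cstar_norm expf_neq0// gt_eqF.
rewrite starmZ normrZ gtr0_norm// starmM starm_star.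
have -> : `|star (f x) * f x| = `|f x| ^+ 2 by exact: cstar_norm.
rewrite /c -mulrA mulrC ler_pdivrMr// mul1r ler_pdivrMl ?exprn_gt0// => fx.
rewrite -(@ler_pXn2r _ 2) ?nnegrE ?mulr_ge0// exprMn (le_trans fx)//.
by rewrite mulrC ler_pM2r ?exprn_gt0// expr2 ler_pMl// ler1n.
Qed.

End StarMorphisms.

Section Generation.
Variables (R : realType) (A : cstarType R).

Lemma starm_comp (B C : cstarType R) (f : B -> C) (g : A -> B) :
  star_morphism f -> star_morphism g -> star_morphism (f \o g).
Proof.
move=> fm gm; split=> [a x y|/=|x /=].
- by rewrite /= starmD// starmZ// starmD// starmZ.
- by split=> [|x y]; rewrite /= ?starm1// !starmM.
- by rewrite !starm_star.
Qed.

Lemma starm_id : star_morphism (@id A).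
Proof. by split. Qed.

(** The set where two morphisms agree is a closed star-subalgebra, the closedness
    because morphisms are bounded. *)
Lemma starm_eq_on_generators (B : cstarType R) (f g : A -> B) (G : set A) :
  smallest [set X | closed_star_subalgebra X] G = setT ->
  star_morphism f -> star_morphism g -> (forall x, G x -> f x = g x) ->
  forall x, f x = g x.
Proof.
move=> genG fm gm fg x.
have : setT x by [].
rewrite -genG => /(_ [set y | f y = g y]); apply; split=> //; split => /=.
- apply: closed_of_approx => y apx; apply/subr0_eq/normr0_eq0.
  apply/eqP; rewrite eq_le normr_ge0 andbT; apply/ler_addgt0Pl => e e0.
  have [w /= fgw lw] := apx (e / 4) (divr_gt0 e0 (ltr0n _ 4)).
  rewrite addr0 -(subrKA (f w)) {2}fgw -(starmB fm) -(starmB gm).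
  rewrite (le_trans (ler_normD _ _))//.
  have -> : e = 2 * (e / 4) + 2 * (e / 4).
    by rewrite -mulrDl -natrD mulrC divfK// pnatr_eq0.
  apply: lerD; rewrite (le_trans (starm_norm_le _ _))// ler_pM2l// ltW//.
  by rewrite distrC.
- by move=> a y z fy fz; rewrite !(starmD, starmZ)// fy fz.
- by move=> y z fy fz; rewrite !starmM// fy fz.
- by move=> y fy; rewrite !starm_star// fy.
Qed.

End Generation.

(** * Hilbert spaces *)

Section ComplexNorm.
Variable R : realType.

Definition sqnormc (a : R[i]) : R := complex.Re a ^+ 2 + complex.Im a ^+ 2.

Lemma sqnormc_ge0 a : 0 <= sqnormc a.
Proof. by rewrite addr_ge0 ?sqr_ge0. Qed.

Lemma normc_sqrt (a : R[i]) : `|a| = (Num.sqrt (sqnormc a))%:C%C.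
Proof. exact: normc_def. Qed.

Lemma conj_mul_sqnormc (a : R[i]) : a^* * a = (sqnormc a)%:C%C.
Proof.
case: a => x y; rewrite /sqnormc; apply/eqP; rewrite eq_complex /=.
by apply/andP; split; apply/eqP; ring.
Qed.

End ComplexNorm.

(** A complex Hilbert space given by the real part [rip] of its inner product. The
    complex inner product is recovered from the values of [rip] at [x] and [i x], and
    its sesquilinearity is [ripZl]: the adjoint of multiplication by a scalar is
    multiplication by the conjugate. *)
Record hilbert (R : realType) := Hilbert {
  hcar :> lmodType R[i];
  rip : hcar -> hcar -> R;
  ripC : forall x y, rip x y = rip y x;
  ripDl : forall x y z, rip (x + y) z = rip x z + rip y z;
  ripRl : forall (r : R) x y, rip (r%:C%C *: x) y = r * rip x y;
  ripZl : forall (a : R[i]) x y, rip (a *: x) y = rip x (a^* *: y);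
  rip_ge0 : forall x, 0 <= rip x x;
  rip_eq0 : forall x, rip x x = 0 -> x = 0;
  rip_complete : forall (x : nat -> hcar) (c : R),
    (forall n m, rip (x (n + m)%N - x n) (x (n + m)%N - x n) <= (c * 2^-1 ^+ n) ^+ 2) ->
    exists l, forall n, rip (l - x n) (l - x n) <= (c * 2^-1 ^+ n) ^+ 2
}.

Section HilbertTheory.
Variables (R : realType) (H : hilbert R).
Implicit Types (x y z : H) (a : R[i]).

Lemma ripDr x y z : rip x (y + z) = rip x y + rip x z.
Proof. by rewrite !(ripC x) ripDl. Qed.

Lemma rip0l y : rip (0 : H) y = 0.
Proof. by apply: (addrI (rip 0 y)); rewrite -ripDl !addr0. Qed.

Lemma rip0r y : rip y (0 : H) = 0.
Proof. by rewrite ripC rip0l. Qed.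

Lemma ripNl x y : rip (- x) y = - rip x y.
Proof. by apply: (addrI (rip x y)); rewrite -ripDl !subrr rip0l. Qed.

Lemma ripNr x y : rip x (- y) = - rip x y.
Proof. by rewrite ripC ripNl ripC. Qed.

Lemma ripBl x y z : rip (x - y) z = rip x z - rip y z.
Proof. by rewrite ripDl ripNl. Qed.

Lemma ripBr x y z : rip x (y - z) = rip x y - rip x z.
Proof. by rewrite ripDr ripNr. Qed.

Lemma ripRr (r : R) x y : rip x (r%:C%C *: y) = r * rip x y.
Proof. by rewrite ripC ripRl ripC. Qed.

Lemma ripZr a x y : rip x (a *: y) = rip (a^* *: x) y.
Proof. by rewrite ripC ripZl ripC. Qed.

Lemma rip_inj x y : (forall z, rip x z = rip y z) -> x = y.
Proof.
by move=> xy; apply/subr0_eq/rip_eq0; rewrite ripBl xy subrr.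
Qed.

Definition hnorm x := Num.sqrt (rip x x).

Lemma hnorm_ge0 x : 0 <= hnorm x.
Proof. exact: sqrtr_ge0. Qed.

Lemma sqr_hnorm x : hnorm x ^+ 2 = rip x x.
Proof. by rewrite sqr_sqrtr// rip_ge0. Qed.

Lemma hnorm0 : hnorm 0 = 0.
Proof. by rewrite /hnorm rip0l sqrtr0. Qed.

Lemma hnorm_eq0 x : hnorm x = 0 -> x = 0.
Proof. by move=> x0; apply: rip_eq0; rewrite -sqr_hnorm x0 expr0n. Qed.

Lemma hnorm_gt0 x : x != 0 -> 0 < hnorm x.
Proof.
move=> x0; rewrite lt_def hnorm_ge0 andbT; apply: contraNneq x0 => /hnorm_eq0.
by move=> ->.
Qed.

Lemma hnormZ a x : hnorm (a *: x) = Num.sqrt (sqnormc a) * hnorm x.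
Proof.
by rewrite /hnorm ripZl scalerA conj_mul_sqnormc ripRr sqrtrM ?sqnormc_ge0.
Qed.

Lemma cauchy_schwarz x y : rip x y <= hnorm x * hnorm y.
Proof.
have [->|y0] := eqVneq y 0; first by rewrite rip0r hnorm0 mulr0.
have yp := hnorm_gt0 y0; have y2 : 0 < rip y y by rewrite -sqr_hnorm exprn_gt0.
apply: (le_trans (ler_norm _)).
rewrite -(@ler_pXn2r _ 2) ?nnegrE ?mulr_ge0 ?hnorm_ge0// exprMn !sqr_hnorm.
rewrite real_normK ?num_real//.
have := rip_ge0 ((rip y y)%:C%C *: x - (rip x y)%:C%C *: y).
rewrite ripBl !ripBr !ripRl !ripRr (ripC y x).
have -> : rip y y * (rip y y * rip x x) - rip y y * (rip x y * rip x y) -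
   (rip x y * (rip y y * rip x y) - rip x y * (rip x y * rip y y)) =
   rip y y * (rip x x * rip y y - rip x y ^+ 2) by ring.
by rewrite pmulr_rge0// subr_ge0.
Qed.

Lemma hnormD x y : hnorm (x + y) <= hnorm x + hnorm y.
Proof.
rewrite -(@ler_pXn2r _ 2) ?nnegrE ?addr_ge0 ?hnorm_ge0// sqr_hnorm.
rewrite ripDl !ripDr (ripC y x) sqrrD -!sqr_hnorm.
have := cauchy_schwarz x y; lra.
Qed.

Lemma hnormN x : hnorm (- x) = hnorm x.
Proof. by rewrite /hnorm ripNl ripNr opprK. Qed.

Lemma hnorm_distC x y : hnorm (x - y) = hnorm (y - x).
Proof. by rewrite -hnormN opprB. Qed.

Lemma hnorm_distD z x y : hnorm (x - y) <= hnorm (x - z) + hnorm (z - y).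
Proof. by rewrite -(subrKA z) hnormD. Qed.

Lemma hnorm_complete (x : nat -> H) (c : R) : 0 <= c ->
    (forall n m, hnorm (x (n + m)%N - x n) <= c * 2^-1 ^+ n) ->
  exists l, forall n, hnorm (l - x n) <= c * 2^-1 ^+ n.
Proof.
move=> c0 xc.
have cn n : 0 <= c * 2^-1 ^+ n by rewrite mulr_ge0// exprn_ge0.
have [n m|l lx] := @rip_complete _ H x c.
  by rewrite -sqr_hnorm ler_pXn2r// nnegrE ?hnorm_ge0.
exists l => n.
by rewrite -(@ler_pXn2r _ 2) ?nnegrE ?hnorm_ge0// sqr_hnorm.
Qed.

End HilbertTheory.

(** * The C*-algebra of bounded operators *)

(** A bounded operator is stored together with its adjoint, so that neither the
    Riesz representation theorem nor a choice of adjoint is involved; additivity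
    is a consequence of the adjoint relation. *)
Record bop (R : realType) (H : hilbert R) := Bop {
  bfun :> H -> H;
  badj : H -> H;
  badjP : forall x y, rip (bfun x) y = rip x (badj y);
  bfunZ : forall (a : R[i]) x, bfun (a *: x) = a *: bfun x;
  bbounded : exists2 M, 0 <= M & forall x, hnorm (bfun x) <= M * hnorm x
}.

HB.instance Definition _ (R : realType) (H : hilbert R) := gen_eqMixin (bop H).
HB.instance Definition _ (R : realType) (H : hilbert R) := gen_choiceMixin (bop H).

Section OperatorNorm.
Variables (R : realType) (H : hilbert R).
Implicit Types (x y z : H) (a : R[i]) (S T : bop H).

Lemma bop_ext S T : (forall x, S x = T x) -> S = T.
Proof.
case: S T => [f f' fP fZ fB] [g g' gP gZ gB] /= /funext fg.
case: _ / fg in gP gZ gB *.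
have fg' : f' = g'.
  apply/funext => y; apply: rip_inj => z.
  by rewrite !(ripC _ z) -fP gP.
case: _ / fg' in gP *.
by congr Bop; exact: Prop_irrelevance.
Qed.

Lemma bfunD T x y : T (x + y) = T x + T y.
Proof. by apply: rip_inj => z; rewrite badjP !ripDl !badjP. Qed.

Lemma bfun0 T : T 0 = 0.
Proof. by apply: (addrI (T 0)); rewrite -bfunD !addr0. Qed.

Definition opn T : R :=
  inf [set M | 0 <= M /\ forall x, hnorm (T x) <= M * hnorm x].

Lemma opn_ge0 T : 0 <= opn T.
Proof.
by apply: lb_le_inf => [|M []//]; case: (bbounded T) => M M0 TM; exists M.
Qed.

Lemma opn_bound T x : hnorm (T x) <= opn T * hnorm x.
Proof.
have [->|x0] := eqVneq x 0; first by rewrite bfun0 !hnorm0 mulr0.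
rewrite -ler_pdivrMr ?hnorm_gt0//; apply: lb_le_inf => [|M [M0 TM]].
  by case: (bbounded T) => M M0 TM; exists M.
by rewrite ler_pdivrMr ?hnorm_gt0.
Qed.

Lemma opn_le T M : 0 <= M -> (forall x, hnorm (T x) <= M * hnorm x) -> opn T <= M.
Proof. by move=> M0 TM; apply: ge_inf => //; exists 0 => N []. Qed.

(** The square of the norm of [T^* y] is the inner product of [T T^* y] and [y]. *)
Lemma badj_bound T y : hnorm (badj T y) <= opn T * hnorm y.
Proof.
have [->|y0] := eqVneq (badj T y) 0.
  by rewrite hnorm0 mulr_ge0 ?opn_ge0 ?hnorm_ge0.
rewrite -(ler_pM2r (hnorm_gt0 y0)) -expr2 sqr_hnorm -badjP.
rewrite (le_trans (cauchy_schwarz _ _))// mulrAC ler_wpM2r ?hnorm_ge0//.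
exact: opn_bound.
Qed.

Lemma badjZ T a y : badj T (a *: y) = a *: badj T y.
Proof.
by apply: rip_inj => z; rewrite !(ripC _ z) -badjP ripZr -bfunZ badjP -ripZr.
Qed.

Lemma bop0_subproof1 x y : rip (0 : H) y = rip x 0.
Proof. by rewrite rip0l rip0r. Qed.
Lemma bop0_subproof2 a (x : H) : 0 = a *: (0 : H).
Proof. by rewrite scaler0. Qed.
Lemma bop0_subproof3 : exists2 M, 0 <= M & forall x, hnorm (0 : H) <= M * hnorm x.
Proof. by exists 0 => // x; rewrite hnorm0 mul0r. Qed.
Definition bop0 : bop H := Bop bop0_subproof1 bop0_subproof2 bop0_subproof3.

Lemma bop1_subproof : exists2 M, 0 <= M & forall x : H, hnorm x <= M * hnorm x.
Proof. by exists 1 => // x; rewrite mul1r. Qed.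
Definition bop1 : bop H :=
  @Bop _ H id id (fun _ _ => erefl) (fun _ _ => erefl) bop1_subproof.

Lemma bopD_subproof1 S T x y : rip (S x + T x) y = rip x (badj S y + badj T y).
Proof. by rewrite ripDl ripDr !badjP. Qed.
Lemma bopD_subproof2 S T a x : S (a *: x) + T (a *: x) = a *: (S x + T x).
Proof. by rewrite !bfunZ scalerDr. Qed.
Lemma bopD_bound S T x : hnorm (S x + T x) <= (opn S + opn T) * hnorm x.
Proof. by rewrite (le_trans (hnormD _ _))// mulrDl lerD ?opn_bound. Qed.
Lemma bopD_subproof3 S T :
  exists2 M, 0 <= M & forall x, hnorm (S x + T x) <= M * hnorm x.
Proof. by exists (opn S + opn T); [rewrite addr_ge0 ?opn_ge0|exact: bopD_bound]. Qed.
Definition bopD S T : bop H :=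
  Bop (bopD_subproof1 S T) (bopD_subproof2 S T) (bopD_subproof3 S T).

Lemma bopZ_subproof1 a T x y : rip (a *: T x) y = rip x (a^* *: badj T y).
Proof. by rewrite ripZl badjP badjZ. Qed.
Lemma bopZ_subproof2 a T b x : a *: T (b *: x) = b *: (a *: T x).
Proof. by rewrite bfunZ !scalerA mulrC. Qed.
Lemma bopZ_bound a T x : hnorm (a *: T x) <= Num.sqrt (sqnormc a) * opn T * hnorm x.
Proof. by rewrite hnormZ -mulrA ler_wpM2l ?sqrtr_ge0 ?opn_bound. Qed.
Lemma bopZ_subproof3 a T :
  exists2 M, 0 <= M & forall x, hnorm (a *: T x) <= M * hnorm x.
Proof.
exists (Num.sqrt (sqnormc a) * opn T); last exact: bopZ_bound.
by rewrite mulr_ge0 ?sqrtr_ge0 ?opn_ge0.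
Qed.
Definition bopZ a T : bop H :=
  Bop (bopZ_subproof1 a T) (bopZ_subproof2 a T) (bopZ_subproof3 a T).

Lemma bopM_subproof1 S T x y : rip (S (T x)) y = rip x (badj T (badj S y)).
Proof. by rewrite !badjP. Qed.
Lemma bopM_subproof2 S T a x : S (T (a *: x)) = a *: S (T x).
Proof. by rewrite !bfunZ. Qed.
Lemma bopM_bound S T x : hnorm (S (T x)) <= opn S * opn T * hnorm x.
Proof.
by rewrite (le_trans (opn_bound _ _))// -mulrA ler_wpM2l ?opn_ge0 ?opn_bound.
Qed.
Lemma bopM_subproof3 S T :
  exists2 M, 0 <= M & forall x, hnorm (S (T x)) <= M * hnorm x.
Proof. by exists (opn S * opn T); [rewrite mulr_ge0 ?opn_ge0|exact: bopM_bound]. Qed.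
Definition bopM S T : bop H :=
  Bop (bopM_subproof1 S T) (bopM_subproof2 S T) (bopM_subproof3 S T).

Lemma bop_star_subproof1 T x y : rip (badj T x) y = rip x (T y).
Proof. by rewrite ripC -badjP ripC. Qed.
Lemma bop_star_subproof3 T :
  exists2 M, 0 <= M & forall x, hnorm (badj T x) <= M * hnorm x.
Proof. by exists (opn T); [exact: opn_ge0|exact: badj_bound]. Qed.
Definition bop_star T : bop H :=
  Bop (bop_star_subproof1 T) (badjZ T) (bop_star_subproof3 T).

Lemma bopDA : associative bopD.
Proof. by move=> S T U; apply: bop_ext => x /=; rewrite addrA. Qed.
Lemma bopDC : commutative bopD.
Proof. by move=> S T; apply: bop_ext => x /=; rewrite addrC. Qed.
Lemma bop0D : left_id bop0 bopD.
Proof. by move=> T; apply: bop_ext => x /=; rewrite add0r. Qed.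
Lemma bopND : left_inverse bop0 (bopZ (-1)) bopD.
Proof. by move=> T; apply: bop_ext => x /=; rewrite scaleN1r addNr. Qed.
HB.instance Definition _ := GRing.isZmodule.Build (bop H) bopDA bopDC bop0D bopND.

Lemma bopZA a b T : bopZ a (bopZ b T) = bopZ (a * b) T.
Proof. by apply: bop_ext => x /=; rewrite scalerA. Qed.
Lemma bopZ1 : left_id 1 bopZ.
Proof. by move=> T; apply: bop_ext => x /=; rewrite scale1r. Qed.
Lemma bopZDr : right_distributive bopZ +%R.
Proof. by move=> a S T; apply: bop_ext => x /=; rewrite scalerDr. Qed.
Lemma bopZDl T : {morph bopZ^~ T : a b / a + b >-> a + b}.
Proof. by move=> a b; apply: bop_ext => x /=; rewrite scalerDl. Qed.
HB.instance Definition _ :=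
  GRing.Zmodule_isLmodule.Build R[i] (bop H) bopZA bopZ1 bopZDr bopZDl.

Let norm T : R[i] := (opn T)%:C%C.

Lemma bop_normD S T : norm (S + T) <= norm S + norm T.
Proof.
rewrite /norm -rmorphD lecR; apply: opn_le; first by rewrite addr_ge0 ?opn_ge0.
exact: bopD_bound.
Qed.

Lemma opnZ_le a T : opn (a *: T) <= Num.sqrt (sqnormc a) * opn T.
Proof.
apply: opn_le; first by rewrite mulr_ge0 ?sqrtr_ge0 ?opn_ge0.
exact: bopZ_bound.
Qed.

Lemma bop_normZ a T : norm (a *: T) = `|a| * norm T.
Proof.
apply/eqP; rewrite eq_le; apply/andP; split.
  by rewrite /norm normc_sqrt -rmorphM lecR opnZ_le.
have [->|a0] := eqVneq a 0.
  by rewrite normr0 mul0r /norm (ler0c (opn _)) opn_ge0.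
rewrite -ler_pdivlMl ?normr_gt0// -normfV.
rewrite -{1}(scale1r T) -(mulVf a0) -scalerA.
by rewrite /norm normc_sqrt -rmorphM lecR opnZ_le.
Qed.

Lemma bop_norm_eq0 T : norm T = 0 -> T = 0.
Proof.
case=> T0; apply: bop_ext => x /=; apply/hnorm_eq0/le_anti.
by rewrite hnorm_ge0 andbT (le_trans (opn_bound _ _))// T0 mul0r.
Qed.

HB.instance Definition _ :=
  Lmodule_isNormed.Build R[i] (bop H) bop_normD bop_normZ bop_norm_eq0.

Lemma bop_normE T : `|T| = (opn T)%:C%C.
Proof. by []. Qed.

End OperatorNorm.

Lemma le_exp_half0_real (R : realType) (c b : R) :
  0 <= b -> (forall n, b <= c * 2^-1 ^+ n) -> b = 0.
Proof.
move=> b0 bc; apply: (@complexI R); apply: (@le_exp_half0 _ c%:C%C) => [|n].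
  by rewrite (ler0c b).
have -> : 2^-1 = (2^-1 : R)%:C%C by rewrite fmorphV rmorph_nat.
by rewrite -rmorphXn -rmorphM lecR.
Qed.

(** A Cauchy filter contains a ball of radius [2^-n] for every [n], and the centres
    of these balls form a sequence converging at a geometric rate. *)
Lemma complete_of_half_cauchy (R : realType) (V : normedModType R[i]) :
  (forall z : nat -> V, (forall n m, `|z (n + m)%N - z n| <= 2 * 2^-1 ^+ n) ->
     exists l, forall n, `|l - z n| <= 2 * 2^-1 ^+ n) ->
  forall F : set_system V, ProperFilter F -> cauchy F -> cvg F.
Proof.
move=> lim_half F FF cF.
have e0 n : 0 < (2^-1 : R[i]) ^+ n by rewrite exprn_gt0.
have [z zF] : exists z : nat -> V, forall n, F (ball (z n) (2^-1 ^+ n)).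
  suff /choice[z zF] : forall n, exists x, F (ball x (2^-1 ^+ n)) by exists z.
  by move=> n; exact: (iffLR (cauchyP _) cF).
have [n m|l lz] := lim_half z.
  have [y [/= zy zy']] := filter_ex (filterI (zF n) (zF (n + m)%N)).
  rewrite -ball_normE /= in zy zy'.
  rewrite (le_trans (ler_distD y _ _))// mulr2n mulrDl mul1r lerD//.
    rewrite (le_trans (ltW zy'))// exprD -[leRHS]mulr1 ler_pM2l//.
    by rewrite exprn_ile1// invf_le1 ?ler1n.
  by rewrite distrC ltW.
apply/cvg_ex; exists l; apply/cvgrPdist_lt => e ep.
have [n lt_n] := exp_half_lt (divr_gt0 ep (ltr0n _ 3)).
apply: filterS (zF n) => y; rewrite -ball_normE /= => zy.
rewrite (le_lt_trans (ler_distD (z n) _ _))//.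
have -> : e = 2 * (e / 3) + e / 3.
  by rewrite -[X in _ + X]mul1r -mulrDl natr1 mulrC divfK ?pnatr_eq0.
apply: ltrD; last exact: lt_trans zy lt_n.
by rewrite (le_lt_trans (lz n))// ltr_pM2l.
Qed.

Section OperatorAlgebra.
Variables (R : realType) (H : hilbert R).
Implicit Types (x y z : H) (a : R[i]) (S T : bop H).

Lemma badjB S T y : badj (S - T) y = badj S y - badj T y.
Proof.
apply: rip_inj => z; rewrite ripBl !(ripC _ z) -!badjP -ripBl.
by congr rip; rewrite -scaleN1r.
Qed.

Lemma bop_sub_apply S T x : (S - T) x = S x - T x.
Proof. by rewrite -scaleN1r. Qed.

(** Strong limits of operators and of their adjoints form an adjoint pair. *)
Lemma bop_half_cauchy_cvg (T : nat -> bop H) :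
  (forall n m, `|T (n + m)%N - T n| <= 2 * 2^-1 ^+ n) ->
  exists L, forall n, `|L - T n| <= 2 * 2^-1 ^+ n.
Proof.
have halfC n : 2 * 2^-1 ^+ n = (2 * 2^-1 ^+ n : R)%:C%C.
  by rewrite rmorphM rmorphXn fmorphV !rmorph_nat.
move=> cT.
have {}cT n m : opn (T (n + m)%N - T n) <= 2 * 2^-1 ^+ n.
  by have := cT n m; rewrite bop_normE halfC lecR.
have lim_x x : exists l, forall n, hnorm (l - T n x) <= 2 * hnorm x * 2^-1 ^+ n.
  apply: hnorm_complete => [|n m]; first by rewrite mulr_ge0 ?hnorm_ge0.
  rewrite -bop_sub_apply (le_trans (opn_bound _ _))// mulrAC.
  by rewrite ler_wpM2r ?hnorm_ge0.
have lim_y y : exists l, forall n, hnorm (l - badj (T n) y) <= 2 * hnorm y * 2^-1 ^+ n.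
  apply: hnorm_complete => [|n m]; first by rewrite mulr_ge0 ?hnorm_ge0.
  rewrite -badjB (le_trans (badj_bound _ _))// mulrAC.
  by rewrite ler_wpM2r ?hnorm_ge0.
have {lim_x} [L LT] := choice lim_x; have {lim_y} [L' LT'] := choice lim_y.
have cs x y c : hnorm x <= c -> `|rip x y| <= c * hnorm y.
  move=> xc; rewrite ler_norml -lerNl -ripNl.
  rewrite !(le_trans (cauchy_schwarz _ _)) ?hnormN ?ler_wpM2r ?hnorm_ge0//.
have Ladj x y : rip (L x) y = rip x (L' y).
  apply/subr0_eq/normr0_eq0.
  apply: (@le_exp_half0_real _ (4 * hnorm x * hnorm y)) => // n.
  have -> : rip (L x) y - rip x (L' y) =
      rip (L x - T n x) y - rip (L' y - badj (T n) y) x.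
    by rewrite !ripBl badjP (ripC (badj _ _)) (ripC (L' y)); ring.
  rewrite (le_trans (ler_normB _ _))//.
  have := cs _ y _ (LT x n); have := cs _ x _ (LT' y n).
  have -> : 4 * hnorm x * hnorm y * 2^-1 ^+ n =
    2 * hnorm y * 2^-1 ^+ n * hnorm x + 2 * hnorm x * 2^-1 ^+ n * hnorm y by ring.
  move=> h1 h2; rewrite addrC; exact: lerD.
have Llin a x : L (a *: x) = a *: L x.
  apply/subr0_eq/hnorm_eq0.
  apply: (@le_exp_half0_real _ (4 * hnorm (a *: x))) => [|n]; first exact: hnorm_ge0.
  rewrite (le_trans (hnorm_distD (T n (a *: x)) _ _))//.
  have -> : 4 * hnorm (a *: x) * 2^-1 ^+ n = 2 * hnorm (a *: x) * 2^-1 ^+ n +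
    Num.sqrt (sqnormc a) * (2 * hnorm x * 2^-1 ^+ n) by rewrite hnormZ; ring.
  apply: lerD => //.
  by rewrite bfunZ -scalerBr hnormZ hnorm_distC ler_wpM2l ?sqrtr_ge0.
have Lbd : exists2 M, 0 <= M & forall x, hnorm (L x) <= M * hnorm x.
  exists (2 + opn (T 0%N)) => [|x]; first by rewrite addr_ge0 ?opn_ge0.
  rewrite -(subrK (T 0%N x) (L x)) (le_trans (hnormD _ _))// mulrDl lerD ?opn_bound//.
  by rewrite (le_trans (LT x 0%N))// expr0 mulr1.
exists (Bop Ladj Llin Lbd) => n; rewrite bop_normE halfC lecR.
apply: opn_le => [|x]; first by rewrite mulr_ge0 ?exprn_ge0.
by rewrite bop_sub_apply mulrAC.
Qed.

HB.instance Definition _ := Uniform_isComplete.Build (bop H)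
  (complete_of_half_cauchy bop_half_cauchy_cvg).

Lemma bopMA : associative (@bopM R H).
Proof. by move=> S T U; exact: bop_ext. Qed.
Lemma bop1M : left_id (bop1 H) (@bopM R H).
Proof. by move=> T; exact: bop_ext. Qed.
Lemma bopM1 : right_id (bop1 H) (@bopM R H).
Proof. by move=> T; exact: bop_ext. Qed.
Lemma bopMDl : left_distributive (@bopM R H) +%R.
Proof. by move=> S T U; exact: bop_ext. Qed.
Lemma bopMDr : right_distributive (@bopM R H) +%R.
Proof. by move=> S T U; apply: bop_ext => x /=; rewrite bfunD. Qed.
Lemma bopMZl a S T : bopM (a *: S) T = a *: bopM S T.
Proof. exact: bop_ext. Qed.
Lemma bopMZr a S T : bopM S (a *: T) = a *: bopM S T.
Proof. by apply: bop_ext => x /=; rewrite bfunZ. Qed.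
Lemma bop_normM S T : `|bopM S T| <= `|S| * `|T|.
Proof.
rewrite !bop_normE -rmorphM lecR; apply: opn_le; first by rewrite mulr_ge0 ?opn_ge0.
exact: bopM_bound.
Qed.
Lemma bop_starK : involutive (@bop_star R H).
Proof. by move=> T; exact: bop_ext. Qed.
Lemma bop_starD : {morph @bop_star R H : S T / S + T}.
Proof. by move=> S T; exact: bop_ext. Qed.
Lemma bop_starZ a T : bop_star (a *: T) = a^* *: bop_star T.
Proof. exact: bop_ext. Qed.
Lemma bop_starM S T : bop_star (bopM S T) = bopM (bop_star T) (bop_star S).
Proof. exact: bop_ext. Qed.
Lemma bop_cstar_norm T : `|bopM (bop_star T) T| = `|T| ^+ 2.
Proof.
rewrite !bop_normE -rmorphXn; congr (_%:C)%C; apply: le_anti; apply/andP; split.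
  apply: opn_le => [|x]; first by rewrite exprn_ge0 ?opn_ge0.
  by rewrite /= (le_trans (badj_bound _ _))// expr2 -mulrA ler_wpM2l ?opn_ge0 ?opn_bound.
rewrite -[leRHS]sqr_sqrtr ?opn_ge0// ler_pXn2r ?nnegrE ?opn_ge0 ?sqrtr_ge0//.
apply: opn_le => [|x]; first exact: sqrtr_ge0.
rewrite -(@ler_pXn2r _ 2) ?nnegrE ?mulr_ge0 ?hnorm_ge0 ?sqrtr_ge0//.
rewrite exprMn !sqr_hnorm sqr_sqrtr ?opn_ge0// badjP ripC -[rip x x]sqr_hnorm.
rewrite (le_trans (cauchy_schwarz _ _))// expr2 mulrA ler_wpM2r ?hnorm_ge0//.
exact: (opn_bound (bopM (bop_star T) T)).
Qed.

HB.instance Definition _ := isCStarAlgebra.Build R (bop H)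
  bopMA bop1M bopM1 bopMDl bopMDr bopMZl bopMZr bop_normM
  bop_starK bop_starD bop_starZ bop_starM bop_cstar_norm.

End OperatorAlgebra.

(** * Sums of nonnegative families *)

Section NonnegSums.
Variables (R : realType) (I : choiceType).
Implicit Types (a b : I -> R).

Definition nnsum a : R := fine (\esum_(i in [set: I]) (a i)%:E).
Definition nnsummable a : Prop := (\esum_(i in [set: I]) (a i)%:E < +oo)%E.

Lemma nnsumE a : (forall i, 0 <= a i) -> nnsummable a ->
  \esum_(i in [set: I]) (a i)%:E = (nnsum a)%:E.
Proof.
by move=> a0 sa; rewrite fineK// ge0_fin_numE// esum_ge0// => i _; rewrite lee_fin.
Qed.

Lemma nnsum_ge0 a : (forall i, 0 <= a i) -> 0 <= nnsum a.
Proof. by move=> a0; apply/fine_ge0/esum_ge0 => i _; rewrite lee_fin. Qed.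

Lemma nnsummable_le a b : (forall i, a i <= b i) -> nnsummable b -> nnsummable a.
Proof. by move=> ab; apply/le_lt_trans/le_esum => i _; rewrite lee_fin. Qed.

Lemma esumEFinD a b : (forall i, 0 <= a i) -> (forall i, 0 <= b i) ->
  \esum_(i in [set: I]) (a i + b i)%:E =
  (\esum_(i in [set: I]) (a i)%:E + \esum_(i in [set: I]) (b i)%:E)%E.
Proof.
by move=> a0 b0; rewrite -esumD// => i _; rewrite lee_fin.
Qed.

Lemma nnsummableD a b : (forall i, 0 <= a i) -> (forall i, 0 <= b i) ->
  nnsummable a -> nnsummable b -> nnsummable (fun i => a i + b i).
Proof. by move=> a0 b0 sa sb; rewrite /nnsummable esumEFinD// lte_add_pinfty. Qed.

Lemma nnsumD a b : (forall i, 0 <= a i) -> (forall i, 0 <= b i) ->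
  nnsummable a -> nnsummable b ->
  nnsum (fun i => a i + b i) = nnsum a + nnsum b.
Proof.
by move=> a0 b0 sa sb; rewrite /nnsum esumEFinD// !nnsumE.
Qed.

Lemma nnsummable_bound a M : (forall i, 0 <= a i) ->
  (forall r : seq I, uniq r -> \sum_(i <- r) a i <= M) -> nnsummable a /\ nnsum a <= M.
Proof.
move=> a0 aM.
have leM : (\esum_(i in [set: I]) (a i)%:E <= M%:E)%E.
  apply: ge_ereal_sup => _ [X [finX _] <-].
  by rewrite fsumEFin// lee_fin fsbig_finite// aM// finmap.fset_uniq.
have sa : nnsummable a by rewrite /nnsummable (le_lt_trans leM) ?ltry.
by split=> //; rewrite -lee_fin -nnsumE.
Qed.

Lemma nnsum_ge a (r : seq I) : (forall i, 0 <= a i) -> nnsummable a ->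
  uniq r -> \sum_(i <- r) a i <= nnsum a.
Proof.
move=> a0 sa ur; rewrite -lee_fin -nnsumE//.
apply: esum_ge; exists [set` r]; first by split=> //; exact: finite_seq.
by rewrite -fsbig_seq// sumEFin lexx.
Qed.

Lemma nnsum_ge1 a i : (forall i, 0 <= a i) -> nnsummable a -> a i <= nnsum a.
Proof. by move=> a0 sa; have := @nnsum_ge a [:: i] a0 sa isT; rewrite big_seq1. Qed.

Lemma nnsummableZ (c : R) a : (forall i, 0 <= a i) -> 0 <= c ->
  nnsummable a -> nnsummable (fun i => c * a i) /\ nnsum (fun i => c * a i) <= c * nnsum a.
Proof.
move=> a0 c0 sa; apply: nnsummable_bound => [i|r ur]; first by rewrite mulr_ge0.
by rewrite -mulr_sumr ler_wpM2l// nnsum_ge.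
Qed.

Lemma nnsumZ (c : R) a : (forall i, 0 <= a i) -> 0 <= c ->
  nnsummable a -> nnsum (fun i => c * a i) = c * nnsum a.
Proof.
move=> a0 c0 sa; apply/le_anti; rewrite (nnsummableZ a0 c0 sa).2/=.
have [->|cn0] := eqVneq c 0.
  by rewrite mul0r; apply: nnsum_ge0 => i; rewrite mul0r.
have cp : 0 < c by rewrite lt_def cn0.
have ca0 i : 0 <= c * a i by rewrite mulr_ge0.
have cV : 0 <= c^-1 by rewrite invr_ge0.
have := (nnsummableZ ca0 cV (nnsummableZ a0 c0 sa).1).2.
rewrite ler_pdivlMl//; congr (_ * nnsum _ <= _); apply/funext => i.
by rewrite mulKf.
Qed.

End NonnegSums.

(** * Square-summable families *)

Record l2 (R : realType) (I : choiceType) := L2 {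
  l2fun :> I -> R[i];
  l2P : nnsummable (fun i => sqnormc (l2fun i))
}.

HB.instance Definition _ (R : realType) (I : choiceType) := gen_eqMixin (l2 R I).
HB.instance Definition _ (R : realType) (I : choiceType) := gen_choiceMixin (l2 R I).

Section SquareSummable.
Variables (R : realType) (I : choiceType).
Implicit Types (x y z : l2 R I) (a : R[i]).

Lemma l2_ext x y : (forall i, x i = y i) -> x = y.
Proof.
case: x y => [f fP] [g gP] /= /funext fg; case: _ / fg in gP *.
by congr L2; exact: Prop_irrelevance.
Qed.

Lemma sqnormcD (u v : R[i]) :
  sqnormc (u + v) <= sqnormc u + sqnormc u + (sqnormc v + sqnormc v).
Proof.
case: u v => [a b] [c d]; rewrite /sqnormc /=.
have h1 := sqr_ge0 (a - c); have h2 := sqr_ge0 (b - d).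
nra.
Qed.

Lemma sqnormcM (u v : R[i]) : sqnormc (u * v) = sqnormc u * sqnormc v.
Proof. by case: u v => [a b] [c d]; rewrite /sqnormc /=; ring. Qed.

Lemma l2_0_subproof : nnsummable (fun _ : I => sqnormc (0 : R[i])).
Proof.
rewrite /nnsummable esum1 ?ltry// => i _.
by rewrite /sqnormc /= expr0n addr0.
Qed.
Definition l2_0 : l2 R I := L2 l2_0_subproof.

Lemma l2D_subproof (f g : I -> R[i]) :
  nnsummable (fun i => sqnormc (f i)) -> nnsummable (fun i => sqnormc (g i)) ->
  nnsummable (fun i => sqnormc (f i + g i)).
Proof.
move=> fs gs; apply: nnsummable_le => [i|]; first exact: sqnormcD.
have ge0 (h : I -> R[i]) i : 0 <= sqnormc (h i) by exact: sqnormc_ge0.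
have ge02 (h : I -> R[i]) i : 0 <= sqnormc (h i) + sqnormc (h i) by rewrite addr_ge0.
by apply: nnsummableD => //; exact: nnsummableD.
Qed.
Definition l2D x y := L2 (l2D_subproof (l2P x) (l2P y)).

Lemma l2Z_subproof a x : nnsummable (fun i => sqnormc (a * x i)).
Proof.
apply: nnsummable_le => [i|]; first by rewrite sqnormcM; exact: lexx.
apply: (nnsummableZ _ (sqnormc_ge0 a) (l2P x)).1 => i; exact: sqnormc_ge0.
Qed.
Definition l2Z a x := L2 (l2Z_subproof a x).

Lemma l2DA : associative l2D.
Proof. by move=> x y z; apply: l2_ext => i /=; rewrite addrA. Qed.
Lemma l2DC : commutative l2D.
Proof. by move=> x y; apply: l2_ext => i /=; rewrite addrC. Qed.
Lemma l20D : left_id l2_0 l2D.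
Proof. by move=> x; apply: l2_ext => i /=; rewrite add0r. Qed.
Lemma l2ND : left_inverse l2_0 (l2Z (-1)) l2D.
Proof. by move=> x; apply: l2_ext => i /=; rewrite mulN1r addNr. Qed.
HB.instance Definition _ := GRing.isZmodule.Build (l2 R I) l2DA l2DC l20D l2ND.

Lemma l2ZA a b x : l2Z a (l2Z b x) = l2Z (a * b) x.
Proof. by apply: l2_ext => i /=; rewrite mulrA. Qed.
Lemma l2Z1 : left_id 1 l2Z.
Proof. by move=> x; apply: l2_ext => i /=; rewrite mul1r. Qed.
Lemma l2ZDr : right_distributive l2Z +%R.
Proof. by move=> a x y; apply: l2_ext => i /=; rewrite mulrDr. Qed.
Lemma l2ZDl x : {morph l2Z^~ x : a b / a + b >-> a + b}.
Proof. by move=> a b; apply: l2_ext => i /=; rewrite mulrDl. Qed.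
HB.instance Definition _ :=
  GRing.Zmodule_isLmodule.Build R[i] (l2 R I) l2ZA l2Z1 l2ZDr l2ZDl.

Lemma l2BE x y i : (x - y) i = x i - y i.
Proof. by rewrite -(scaleN1r y) /= mulN1r. Qed.

Definition sqn x : R := nnsum (fun i => sqnormc (x i)).

Lemma sqn_ge0 x : 0 <= sqn x.
Proof. by apply: nnsum_ge0 => i; exact: sqnormc_ge0. Qed.

Lemma sqn_ge1 x i : sqnormc (x i) <= sqn x.
Proof. by apply: (nnsum_ge1 _ _ (l2P x)) => j; exact: sqnormc_ge0. Qed.

(** The real part of the usual inner product, obtained by polarization; with it
    only sums of nonnegative families occur, and a linear identity between values
    of [sqn] follows from the same identity at each index. *)
Definition l2ip x y : R := (sqn (x + y) - sqn x - sqn y) / 2.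

(** The tool behind all identities for [l2ip]: terms are moved to the side where they
    appear with a positive sign, and the identity is then checked at each index. *)
Lemma sqn_sum_eq (xs ys : seq (l2 R I)) :
  (forall i, \sum_(x <- xs) sqnormc (x i) = \sum_(y <- ys) sqnormc (y i)) ->
  \sum_(x <- xs) sqn x = \sum_(y <- ys) sqn y.
Proof.
have sum_sqn (zs : seq (l2 R I)) :
    nnsummable (fun i => \sum_(z <- zs) sqnormc (z i)) /\
    \sum_(z <- zs) sqn z = nnsum (fun i => \sum_(z <- zs) sqnormc (z i)).
  elim: zs => [|z zs [IHs IH]].
    have -> : (fun i : I => \sum_(z <- [::]) sqnormc (@l2fun R I z i)) = (fun=> 0).
      by apply/funext => i; rewrite big_nil.
    rewrite big_nil /nnsummable /nnsum esum1//; by split=> //; rewrite ltry.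
  have -> : (fun i : I => \sum_(w <- z :: zs) sqnormc (l2fun w i)) =
      (fun i => sqnormc (z i) + \sum_(w <- zs) sqnormc (l2fun w i)).
    by apply/funext => i; rewrite big_cons.
  have s0 i : 0 <= \sum_(w <- zs) sqnormc (l2fun w i).
    by apply: sumr_ge0 => w _; exact: sqnormc_ge0.
  have z0 i : 0 <= sqnormc (z i) by exact: sqnormc_ge0.
  rewrite big_cons IH nnsumD//; last exact: l2P.
  by split=> //; apply: nnsummableD => //; exact: l2P.
move=> xy; rewrite (sum_sqn xs).2 (sum_sqn ys).2.
by congr nnsum; apply/funext.
Qed.

Lemma sqnZ a x : sqn (a *: x) = sqnormc a * sqn x.
Proof.
rewrite /sqn -nnsumZ ?sqnormc_ge0//; last 2 first.
- by move=> i; exact: sqnormc_ge0.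
- exact: l2P.
by congr nnsum; apply/funext => i; rewrite /= sqnormcM.
Qed.

Lemma sqnormc_real (r : R) : sqnormc r%:C%C = r ^+ 2.
Proof. by rewrite /sqnormc /= expr0n addr0. Qed.

Lemma sqnormc_eq0 (z : R[i]) : sqnormc z = 0 -> z = 0.
Proof.
move=> z0; apply/eqP; rewrite -normr_eq0 normc_sqrt z0 sqrtr0.
by rewrite eq_complex /= !eqxx.
Qed.

Lemma l2ipC x y : l2ip x y = l2ip y x.
Proof. by rewrite /l2ip (addrC x y) addrAC. Qed.

Lemma l2ipxx x : l2ip x x = sqn x.
Proof.
rewrite /l2ip -mulr2n -scaler_nat sqnZ.
have -> : (2 : R[i]) = (2 : R)%:C%C by rewrite rmorph_nat.
by rewrite sqnormc_real; field.
Qed.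

Lemma l2ipDl x y z : l2ip (x + y) z = l2ip x z + l2ip y z.
Proof.
have := @sqn_sum_eq [:: x + y + z; x; y; z] [:: x + y; x + z; y + z].
rewrite !big_cons !big_nil /l2ip => xyz.
suff : sqn (x + y + z) + (sqn x + (sqn y + (sqn z + 0))) =
    sqn (x + y) + (sqn (x + z) + (sqn (y + z) + 0)) by move=> e; lra.
apply: xyz => i; rewrite !big_cons !big_nil /=.
by case: (x i) (y i) (z i) => [a b] [c d] [e f]; rewrite /sqnormc /=; ring.
Qed.

Lemma l2ipZl a x y : l2ip (a *: x) y = l2ip x (a^* *: y).
Proof.
have := @sqn_sum_eq [:: a *: x + y; x; a^* *: y] [:: x + a^* *: y; a *: x; y].
rewrite !big_cons !big_nil /l2ip => xy.
suff : sqn (a *: x + y) + (sqn x + (sqn (a^* *: y) + 0)) =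
    sqn (x + a^* *: y) + (sqn (a *: x) + (sqn y + 0)) by move=> e; lra.
apply: xy => i; rewrite !big_cons !big_nil /=.
by case: a (x i) (y i) => [a b] [c d] [e f]; rewrite /sqnormc /=; ring.
Qed.

(** Scaling by a nonnegative real [r] is written with a square root of [r], which
    turns the multiples of values of [sqn] into values of [sqn]. *)
Lemma l2ip_sqr (s : R) x y : l2ip ((s ^+ 2)%:C%C *: x) y = s ^+ 2 * l2ip x y.
Proof.
pose S : R[i] := s%:C%C.
have := @sqn_sum_eq [:: (s ^+ 2)%:C%C *: x + y; S *: x; S *: y]
  [:: S *: (x + y); (s ^+ 2)%:C%C *: x; y].
rewrite !big_cons !big_nil /l2ip => xy.
suff : sqn ((s ^+ 2)%:C%C *: x + y) + (sqn (S *: x) + (sqn (S *: y) + 0)) =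
    sqn (S *: (x + y)) + (sqn ((s ^+ 2)%:C%C *: x) + (sqn y + 0)).
  by rewrite !(sqnZ S) sqnormc_real => e; lra.
apply: xy => i; rewrite !big_cons !big_nil /=.
by case: (x i) (y i) => [a b] [c d]; rewrite /sqnormc /=; ring.
Qed.

Lemma l2ipRl (r : R) x y : l2ip (r%:C%C *: x) y = r * l2ip x y.
Proof.
have pos t z : 0 <= t -> l2ip (t%:C%C *: z) y = t * l2ip z y.
  by move=> t0; rewrite -(sqr_sqrtr t0) l2ip_sqr.
have [r0|r0] := leP 0 r; first exact: pos.
have l20 : l2ip 0 y = 0.
  by apply: (addrI (l2ip 0 y)); rewrite -l2ipDl !addr0.
have lN : l2ip (- x) y = - l2ip x y.
  by apply: (addrI (l2ip x y)); rewrite -l2ipDl !subrr.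
have -> : r%:C%C *: x = (- r)%:C%C *: (- x).
  by rewrite rmorphN scalerN scaleNr opprK.
by rewrite pos ?oppr_ge0 ?ltW// lN mulrNN.
Qed.

Lemma l2ip_ge0 x : 0 <= l2ip x x.
Proof. by rewrite l2ipxx sqn_ge0. Qed.

Lemma l2ip_eq0 x : l2ip x x = 0 -> x = 0.
Proof.
rewrite l2ipxx => x0; apply: l2_ext => i; apply/sqnormc_eq0/le_anti.
by rewrite sqnormc_ge0 andbT -x0 sqn_ge1.
Qed.

Lemma sqnormc_component (z : R[i]) (c : R) : 0 <= c -> sqnormc z <= c ^+ 2 ->
  `|complex.Re z| <= c /\ `|complex.Im z| <= c.
Proof.
rewrite /sqnormc => c0 zc.
by split; rewrite -(@ler_pXn2r _ 2) ?nnegrE// real_normK ?num_real// (le_trans _ zc)//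
  ?lerDl ?lerDr sqr_ge0.
Qed.

(** Coordinates converge because each is dominated by the norm; the bound on the
    norm of the difference passes to the limit on every finite set of indices. *)
Lemma l2_complete (x : nat -> l2 R I) (c : R) :
  (forall n m, l2ip (x (n + m)%N - x n) (x (n + m)%N - x n) <= (c * 2^-1 ^+ n) ^+ 2) ->
  exists l, forall n, l2ip (l - x n) (l - x n) <= (c * 2^-1 ^+ n) ^+ 2.
Proof.
wlog c0 : c / 0 <= c => [hw xc|xc].
  have abs n : (`|c| * 2^-1 ^+ n) ^+ 2 = (c * 2^-1 ^+ n) ^+ 2.
    by rewrite !exprMn real_normK ?num_real.
  have [n m|l xl] := hw `|c| (normr_ge0 c); first by rewrite abs.
  by exists l => n; rewrite -abs.
have coord i n m : sqnormc (x (n + m)%N i - x n i) <= (c * 2^-1 ^+ n) ^+ 2.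
  apply: le_trans (xc n m); rewrite l2ipxx; apply: le_trans (sqn_ge1 _ i).
  by rewrite l2BE.
have cn n : 0 <= c * 2^-1 ^+ n by rewrite mulr_ge0 ?exprn_ge0.
have lim_re i : exists l, forall n, `|l - complex.Re (x n i)| <= c * 2^-1 ^+ n.
  apply: (@cauchy_half_cvg R R^o) => [|n m]; first exact: exp_half_lt_real.
  have := (sqnormc_component (cn n) (coord i n m)).1.
  by case: (x _ i) (x _ i) => [? ?] [].
have lim_im i : exists l, forall n, `|l - complex.Im (x n i)| <= c * 2^-1 ^+ n.
  apply: (@cauchy_half_cvg R R^o) => [|n m]; first exact: exp_half_lt_real.
  have := (sqnormc_component (cn n) (coord i n m)).2.
  by case: (x _ i) (x _ i) => [? ?] [].
have {lim_re} [lre lreP] := choice lim_re; have {lim_im} [lim limP] := choice lim_im.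
pose l i : R[i] := (lre i +i* lim i)%C.
have half_anti n m : 2^-1 ^+ (n + m) <= 2^-1 ^+ m :> R.
  by rewrite ler_wiXn2l ?leq_addl ?invr_ge0 ?invf_le1 ?ler1n.
have cvg_half (u : nat -> R) v n : (forall m, `|v - u m| <= c * 2^-1 ^+ m) ->
    (fun m => u (n + m)%N) @ \oo --> v.
  move=> uv; apply/cvgrPdist_le => e e0.
  have c1 : 0 < c + 1 by rewrite ltr_wpDl.
  have [k ltk] := exp_half_lt_real (divr_gt0 e0 c1).
  exists k => // m /= km; rewrite (le_trans (uv _))//.
  apply: (@le_trans _ _ ((c + 1) * 2^-1 ^+ k)).
    rewrite ler_pM ?exprn_ge0 ?lerDl// (le_trans (half_anti _ _))//.
    by rewrite -(subnK km) half_anti.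
  by rewrite mulrC -ler_pdivlMr// ltW.
have fin_bound n (r : seq I) : uniq r ->
    \sum_(i <- r) sqnormc (l i - x n i) <= (c * 2^-1 ^+ n) ^+ 2.
  move=> ur.
  have lim_sum : (fun m => \sum_(i <- r) sqnormc (x (n + m)%N i - x n i)) @ \oo -->
      \sum_(i <- r) sqnormc (l i - x n i).
    elim: r {ur} => [|i r IH].
      rewrite big_nil.
      have -> : (fun m => \sum_(i <- [::]) sqnormc (x (n + m)%N i - x n i)) = fun=> 0.
        by apply/funext => m; rewrite big_nil.
      exact: cvg_cst.
    rewrite big_cons.
    have -> : (fun m => \sum_(j <- i :: r) sqnormc (x (n + m)%N j - x n j)) =
        fun m => sqnormc (x (n + m)%N i - x n i)
          + \sum_(j <- r) sqnormc (x (n + m)%N j - x n j).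
      by apply/funext => m; rewrite big_cons.
    apply: cvgD => //.
    have sqE (z w : R[i]) : sqnormc (z - w) =
      (complex.Re z - complex.Re w) * (complex.Re z - complex.Re w) +
      (complex.Im z - complex.Im w) * (complex.Im z - complex.Im w).
      by case: z w => [? ?] [? ?]; rewrite /sqnormc /= !expr2.
    have -> : (fun m => sqnormc (x (n + m)%N i - x n i)) = (fun m =>
      (complex.Re (x (n + m)%N i) - complex.Re (x n i)) *
      (complex.Re (x (n + m)%N i) - complex.Re (x n i)) +
      (complex.Im (x (n + m)%N i) - complex.Im (x n i)) *
      (complex.Im (x (n + m)%N i) - complex.Im (x n i))).
      by apply/funext => m; rewrite sqE.
    have re := cvg_half _ _ n (lreP i); have im := cvg_half _ _ n (limP i).
    have {}re : (fun m => complex.Re (x (n + m)%N i) - complex.Re (x n i)) @ \oo -->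
        complex.Re (l i) - complex.Re (x n i) by apply: cvgB re _; exact: cvg_cst.
    have {}im : (fun m => complex.Im (x (n + m)%N i) - complex.Im (x n i)) @ \oo -->
        complex.Im (l i) - complex.Im (x n i) by apply: cvgB im _; exact: cvg_cst.
    by rewrite sqE; exact: (cvgD (cvgM re re) (cvgM im im)).
  apply: (cvgr_to_le lim_sum); apply: nearW => m.
  apply: le_trans (xc n m); rewrite l2ipxx /sqn.
  have -> : \sum_(i <- r) sqnormc (x (n + m)%N i - x n i) =
      \sum_(i <- r) sqnormc ((x (n + m)%N - x n) i).
    by apply: eq_bigr => i _; rewrite l2BE.
  by apply: nnsum_ge => // [i|]; [exact: sqnormc_ge0|exact: l2P].
have lx n : nnsummable (fun i => sqnormc (l i - x n i)) /\
    nnsum (fun i => sqnormc (l i - x n i)) <= (c * 2^-1 ^+ n) ^+ 2.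
  by apply: nnsummable_bound => [i|r ur]; [exact: sqnormc_ge0|exact: fin_bound].
have lP : nnsummable (fun i => sqnormc (l i)).
  have := l2D_subproof (lx 0%N).1 (l2P (x 0%N)).
  by congr nnsummable; apply/funext => i; rewrite subrK.
exists (L2 lP) => n; rewrite l2ipxx (le_trans _ (lx n).2)// /sqn.
rewrite le_eqVlt; apply/orP; left; apply/eqP; congr nnsum; apply/funext => i.
by rewrite l2BE.
Qed.

Definition l2_hilbert : hilbert R :=
  Hilbert l2ipC l2ipDl l2ipRl l2ipZl l2ip_ge0 l2ip_eq0 l2_complete.

End SquareSummable.

(** * Isometries induced by injections of the index set *)

Section IndexIsometry.
Variables (R : realType) (I : choiceType).
Implicit Types (x y : l2 R I).
Let H := l2_hilbert R I.

Definition basis_vector_fun (n m : I) : R[i] := if m == n then 1 else 0.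

Lemma basis_vector_esum n :
  \esum_(m in [set: I]) (sqnormc (basis_vector_fun n m))%:E = 1%E.
Proof.
have -> : \esum_(m in [set: I]) (sqnormc (basis_vector_fun n m))%:E =
    \esum_(m in [set n]) (1 : R)%:E.
  rewrite [RHS]esum_mkcond; apply: eq_esum => m _.
  have [->|mn] := eqVneq m n.
    by rewrite mem_set// /basis_vector_fun eqxx /sqnormc /= expr1n expr0n addr0.
  rewrite memNset; last exact/eqP.
  by rewrite /basis_vector_fun (negPf mn) /sqnormc /= expr0n addr0.
by rewrite esum_set1 ?lee_fin.
Qed.

Lemma basis_vector_subproof n : nnsummable (fun m => sqnormc (basis_vector_fun n m)).
Proof. by rewrite /nnsummable basis_vector_esum ltry. Qed.
Definition basis_vector n : l2 R I := L2 (basis_vector_subproof n).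

Lemma sqn_basis n : sqn (basis_vector n) = 1.
Proof. by rewrite /sqn /nnsum basis_vector_esum. Qed.

Lemma l2ip_disjoint x y : (forall k, x k = 0 \/ y k = 0) -> l2ip x y = 0.
Proof.
move=> xy; have := @sqn_sum_eq _ _ [:: x + y] [:: x; y].
rewrite !big_cons !big_nil /l2ip => e.
suff : sqn (x + y) + 0 = sqn x + (sqn y + 0) by move=> {}e; lra.
apply: e => k; rewrite !big_cons !big_nil /=.
have sq0 : sqnormc (0 : R[i]) = 0 by rewrite /sqnormc /= expr0n addr0.
by case: (xy k) => ->; rewrite ?add0r ?addr0 sq0 ?add0r ?addr0.
Qed.

(** Scaling the basis vector by [x m] itself makes the real inner product see both
    the real and the imaginary part of the coordinate. *)
Lemma coord_eq0 x m : l2ip x (x m *: basis_vector m) = 0 -> x m = 0.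
Proof.
set e := x m *: basis_vector m.
have em : e m = x m by rewrite /= /basis_vector_fun eqxx mulr1.
have split_x : l2ip x e = l2ip e e.
  rewrite -[in LHS](subrK e x) l2ipDl l2ip_disjoint ?add0r// => k.
  have [->|km] := eqVneq k m; first by left; rewrite l2BE em subrr.
  by right; rewrite /= /basis_vector_fun (negPf km) mulr0.
rewrite split_x l2ipxx => e0; apply/sqnormc_eq0/le_anti.
by rewrite sqnormc_ge0 andbT -[in leLHS]em -e0 sqn_ge1.
Qed.

Variable sigma : I -> I.
Hypothesis sigma_inj : injective sigma.

Definition push (f : I -> R[i]) (m : I) : R[i] :=
  if pselect (exists k, sigma k = m) is left ex then f (sval (cid ex)) else 0.

Lemma push_im f k : push f (sigma k) = f k.
Proof.
rewrite /push; case: pselect => [ex|]; last by case; exists k.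
by congr f; case: (cid ex) => j /= /sigma_inj.
Qed.

Lemma push_notim f m : ~ (exists k, sigma k = m) -> push f m = 0.
Proof. by rewrite /push; case: pselect. Qed.

Lemma esum_split_im (a : I -> \bar R) : (forall i, 0 <= a i)%E ->
  \esum_(i in [set: I]) a i =
  (\esum_(i in [set: I]) a (sigma i) + \esum_(i in ~` range sigma) a i)%E.
Proof.
move=> a0; rewrite (esumID (range sigma))// !setTI esum_image//.
by move=> j k _ _; exact: sigma_inj.
Qed.

Lemma pull_subproof x : nnsummable (fun k => sqnormc (x (sigma k))).
Proof.
have := l2P x; rewrite /nnsummable esum_split_im => [|i]; last first.
  by rewrite lee_fin sqnormc_ge0.
apply: le_lt_trans; rewrite leeDl// esum_ge0// => i _.
by rewrite lee_fin sqnormc_ge0.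
Qed.
Definition l2pull x : l2 R I := L2 (pull_subproof x).

Lemma esum_push x :
  \esum_(i in ~` range sigma) (sqnormc (push x i))%:E = 0%E.
Proof.
apply: esum1 => m mP; rewrite push_notim; first by rewrite /sqnormc /= expr0n addr0.
by case=> k skm; apply: mP; exists k.
Qed.

Lemma push_subproof x : nnsummable (fun m => sqnormc (push x m)).
Proof.
have := l2P x; rewrite /nnsummable [X in _ -> (X < _)%E]esum_split_im => [|i]; last first.
  by rewrite lee_fin sqnormc_ge0.
rewrite esum_push adde0; congr (_ < _)%E; apply: eq_esum => i _.
by rewrite push_im.
Qed.
Definition l2push x : l2 R I := L2 (push_subproof x).

Let rest x : R := fine (\esum_(i in ~` range sigma) (sqnormc (x i))%:E).

Let sqn_split x : sqn x = sqn (l2pull x) + rest x.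
Proof.
have sq0 y i : (0 <= (sqnormc (y i))%:E)%E by rewrite lee_fin sqnormc_ge0.
have e := esum_split_im (fun i => sq0 x i).
have := l2P x; rewrite /nnsummable e => fin.
have fin1 := l2P (l2pull x).
rewrite /sqn /nnsum e fineD//.
- by rewrite ge0_fin_numE ?esum_ge0.
- rewrite ge0_fin_numE ?esum_ge0//; apply: le_lt_trans fin.
  by rewrite leeDr ?esum_ge0.
Qed.

Lemma sqn_push x : sqn (l2push x) = sqn x.
Proof.
rewrite sqn_split /rest esum_push addr0.
by congr sqn; apply: l2_ext => i; rewrite /= push_im.
Qed.

(** Splitting the index set into the range of [sigma] and its complement, the
    vector [push x + y] restricts to [x + pull y] on the range and to [y] off it. *)
Lemma push_adjoint x y : l2ip (l2push x) y = l2ip x (l2pull y).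
Proof.
have e1 : sqn (l2push x + y) = sqn (x + l2pull y) + rest y.
  rewrite sqn_split; congr (sqn _ + fine _).
    by apply: l2_ext => i; rewrite /= push_im.
  apply: eq_esum => m mP; rewrite /= push_notim ?add0r//.
  by case=> k skm; apply: mP; exists k.
by rewrite /l2ip e1 sqn_push (sqn_split y); field.
Qed.

Lemma pushZ (a : R[i]) x : l2push (a *: x) = a *: l2push x.
Proof.
apply: l2_ext => m /=; have [[k <-]|mP] := pselect (exists k, sigma k = m).
  by rewrite !push_im.
by rewrite !push_notim// mulr0.
Qed.

Lemma push_bounded :
  exists2 M, 0 <= M & forall x : H, @hnorm R H (l2push x) <= M * hnorm x.
Proof. by exists 1 => // x; rewrite mul1r /hnorm /= !l2ipxx sqn_push. Qed.

(** The isometry sending the basis vector at [n] to the one at [sigma n]. *)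
Definition index_isometry : bop H :=
  @Bop R H l2push l2pull push_adjoint pushZ push_bounded.

End IndexIsometry.

(** * Banded operators *)

Definition pos_part (n : int) : nat := if n is Posz k then k else 0%N.

(** Comparing positive parts up to an affine distortion is a condition stable under
    composition that shifts and dilations satisfy (dilations do not keep [n - m]
    bounded), and that separates [n] from [k - n] when [n] is large. *)
Definition close (C : nat) (n m : int) : Prop :=
  (pos_part n <= C * (1 + pos_part m))%N /\ (pos_part m <= C * (1 + pos_part n))%N.

Lemma close_sym C n m : close C n m -> close C m n.
Proof. by case. Qed.

Lemma close_le C D n m : (C <= D)%N -> close C n m -> close D n m.
Proof. by rewrite /close => CD [h1 h2]; split; nia. Qed.

Lemma close_trans C D n k m : close C n k -> close D k m ->
  close (C * (1 + D) + D * (1 + C)) n m.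
Proof. by rewrite /close => -[h1 h2] [h3 h4]; split; nia. Qed.

Section Banded.
Variable R : realType.
Let H := l2_hilbert R int.
Let BH : cstarType R := bop H.
Let e (n : int) : H := basis_vector R n.
Implicit Types S T : BH.

Definition banded (C : nat) (T : bop H) : Prop :=
  forall n m, (T (e n) : l2 R int) m != 0 \/ (badj T (e n) : l2 R int) m != 0 ->
  close C n m.

Lemma banded_star C T : banded C T -> banded C (star T : BH).
Proof. by move=> TC n m nm; apply: TC; case: nm => ?; [right|left]. Qed.

Lemma banded_lin C D (a : R[i]) S T : banded C S -> banded D T ->
  banded (maxn C D) (a *: S + T : BH).
Proof.
have nz (u v w : R[i]) : u * v + w != 0 -> v != 0 \/ w != 0.
  move=> uvw; have [v0|] := eqVneq v 0; last by left.
  by right; move: uvw; rewrite v0 mulr0 add0r.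
by move=> SC TD n m [] /nz [] nm;
  [apply: (close_le (leq_maxl C D))|apply: (close_le (leq_maxr C D))
  |apply: (close_le (leq_maxl C D))|apply: (close_le (leq_maxr C D))];
  [apply: SC; left|apply: TD; left|apply: SC; right|apply: TD; right].
Qed.

(** The entry of [S T] at [(n, m)] is an inner product of [T e_n] and [S^* e_m],
    so it vanishes unless these two vectors have a common support point. *)
Lemma mul_coord_neq0 (S T : bop H) n m : (S (T (e n)) : l2 R int) m != 0 ->
  exists k, (T (e n) : l2 R int) k != 0 /\ (badj S (e m) : l2 R int) k != 0.
Proof.
move=> nz; apply: contrapT => nk; move/eqP: nz; apply; apply: coord_eq0.
set c := _ m.
change (rip (S (T (e n))) (c *: e m : H) = 0).
rewrite badjP badjZ; apply: l2ip_disjoint => k.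
have [->|Tk] := eqVneq ((T (e n) : l2 R int) k) 0; first by left.
have [Sk|Sk] := eqVneq ((badj S (e m) : l2 R int) k) 0.
  by right; rewrite /= Sk mulr0.
by case: nk; exists k.
Qed.

Lemma banded_mul C D S T : banded C S -> banded D T ->
  banded (D * (1 + C) + C * (1 + D)) (S * T : BH).
Proof.
move=> SC TD n m [] nm.
  have [k [Tk Sk]] := mul_coord_neq0 nm.
  by apply: (close_trans (k := k)); [apply: TD; left|apply/close_sym/SC; right].
have [k [Tk Sk]] := @mul_coord_neq0 (star T : BH) (star S : BH) n m nm.
rewrite addnC.
by apply: (close_trans (k := k)); [apply: SC; right|apply/close_sym/TD; left].
Qed.

Lemma banded_index_isometry C (sigma : int -> int) (sigma_inj : injective sigma) :
  (forall n, close C n (sigma n)) -> banded C (index_isometry R sigma_inj).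
Proof.
move=> sC n m [] /= nm.
  have [[k km]|nex] := pselect (exists k, sigma k = m); last first.
    by rewrite push_notim ?eqxx in nm.
  move: nm; rewrite -km push_im// /basis_vector_fun.
  by have [->|_] := eqVneq k n; rewrite ?eqxx.
move: nm; rewrite /basis_vector_fun.
by have [<- _|_] := eqVneq (sigma m) n; [apply: close_sym|rewrite eqxx].
Qed.

Lemma antidiagonal_far (C : nat) (k : int) : exists n : nat,
  ~ close C n%:Z (k - n%:Z).
Proof.
(* Beyond [|k|] the positive part of [k - n] is zero, and beyond [C] that of [n]
   exceeds the bound. *)
exists (C + `|k|%N).+1 => -[h _]; move: h => /=.
have -> : pos_part (k - Posz (C + `|k|%N).+1) = 0%N.
  by case E : (k - _) => [j|//] /=; lia.
by lia.
Qed.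

End Banded.

(** * The representation by shift and dilations *)

Section Representation.
Variable R : realType.
Let H := l2_hilbert R int.
Let BH : cstarType R := bop H.
Let e (n : int) : H := basis_vector R n.
Implicit Types (x y : l2 R int).

Lemma addz1_inj : injective (fun n : int => n + 1).
Proof. exact: addIr. Qed.

Lemma mulSz_inj (p : nat) : injective (fun n : int => p.+1%:Z * n).
Proof. by apply: mulfI. Qed.

Definition shift_op : BH := index_isometry R addz1_inj.

(** Multiplication by [0] is not injective, so the value at [0] is arbitrary. *)
Definition dilation_op (p : nat) : BH :=
  if p is q.+1 then index_isometry R (@mulSz_inj q) else 0.

Lemma bop_mulE (S T : BH) x : (S * T : bop H) x = (S : bop H) ((T : bop H) x).
Proof. by []. Qed.

Lemma shift_basis n : (shift_op : bop H) (e n) = e (n + 1).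
Proof.
apply: l2_ext => m /=; have [->|mn] := eqVneq m (n + 1).
  by rewrite (push_im addz1_inj) /basis_vector_fun !eqxx.
have [[k km]|nex] := pselect (exists k : int, k + 1 = m).
  rewrite -km (push_im addz1_inj) /basis_vector_fun -(inj_eq addz1_inj) km.
  by rewrite (negPf mn).
by rewrite push_notim// /basis_vector_fun (negPf mn).
Qed.

(** An operator intertwining the bilateral shift with its adjoint has constant
    entries along the lines [n + m = k], and these lines leave every band. *)
Lemma no_flip_near_banded (W : BH) :
  star W * W = 1 -> W * shift_op = star shift_op * W ->
  ~ (forall eps : R, 0 < eps -> exists C (T : BH), banded C T /\ `|W - T| <= eps%:C%C).
Proof.
move=> WW WU apx.
have entry k (n : nat) : ((W : bop H) (e n) : l2 R int) (k - n%:Z) =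
    ((W : bop H) (e 0) : l2 R int) k.
  elim: n => [|n IH]; first by rewrite subr0.
  have -> : e n.+1 = (shift_op : bop H) (e n) by rewrite shift_basis -PoszD addn1.
  rewrite -bop_mulE WU -IH /=; congr (l2fun _ _).
  by rewrite intS opprD addrA addrAC subrK.
have W0 : (W : bop H) (e 0) = 0.
  apply: l2_ext => k; apply/sqnormc_eq0/le_anti; rewrite sqnormc_ge0 andbT.
  apply/ler_addgt0Pl => r r0; rewrite addr0.
  have eps0 : 0 < Num.sqrt r by rewrite sqrtr_gt0.
  have [C [T [TC le_eps]]] := apx _ eps0.
  have [n far] := antidiagonal_far C k.
  have Tn : ((T : bop H) (e n) : l2 R int) (k - n%:Z) = 0.
    by apply/eqP; apply: contrapT => /negP nz; apply: far; apply: TC; left.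
  rewrite -(entry k n) -[X in sqnormc X]subr0 -{1}Tn -l2BE.
  have -> : ((W : bop H) (e n) : l2 R int) - (T : bop H) (e n) = ((W - T : BH) : bop H) (e n).
    by rewrite (bop_sub_apply (W : bop H)).
  rewrite (le_trans (sqn_ge1 _ _))// -l2ipxx.
  change (@rip R H (((W - T : BH) : bop H) (e n)) (((W - T : BH) : bop H) (e n)) <= r).
  rewrite -sqr_hnorm.
  rewrite -[leRHS](sqr_sqrtr (ltW r0)) ler_pXn2r ?nnegrE ?hnorm_ge0 ?sqrtr_ge0//.
  rewrite (le_trans (opn_bound _ _))// /hnorm.
  have -> : rip (e n) (e n) = 1 by rewrite /= l2ipxx sqn_basis.
  by rewrite sqrtr1 mulr1 -lecR.
have e0 : e 0 = 0.
  have -> : e 0 = (1 : BH) (e 0) by [].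
  by rewrite -WW bop_mulE W0 (bfun0 (star W : bop H)).
have : (e 0 : l2 R int) 0 = 0 by rewrite e0.
by move/eqP; rewrite /= /basis_vector_fun eqxx oner_eq0.
Qed.

End Representation.

Section RepresentationRelations.
Variable R : realType.
Let H := l2_hilbert R int.
Let BH : cstarType R := bop H.
Implicit Types (x y : l2 R int).
Let U : BH := shift_op R.
Let D (p : nat) : BH := dilation_op R p.

Let at_ (T : BH) x k : R[i] := ((T : bop H) x : l2 R int) k.

Let BH_ext (S T : BH) : (forall x k, at_ S x k = at_ T x k) -> S = T.
Proof. by move=> ST; apply: (@bop_ext R H) => x; apply: l2_ext => k; exact: ST. Qed.

Let atM S T x k : at_ (S * T) x k = at_ S ((T : bop H) x) k.
Proof. by []. Qed.

Let at_shift x k : at_ U x k = x (k - 1).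
Proof. by rewrite -{1}(subrK 1 k); exact: (push_im addz1_inj). Qed.

Let at_shift_star x k : at_ (star U) x k = x (k + 1).
Proof. by []. Qed.

Let at_upow m x k : at_ (upow U m) x k = x (k - m).
Proof.
case: m => n /=.
  elim: n x k => [|n IH] x k; first by rewrite subr0.
  by rewrite exprS atM at_shift -[LHS]/(at_ _ _ _) IH intS opprD addrA.
suff -> j : at_ (star U ^+ j) x k = x (k + j%:Z) by rewrite NegzE opprK.
elim: j x k => [|j IH] x k; first by rewrite addr0.
by rewrite exprS atM at_shift_star -[LHS]/(at_ _ _ _) IH intS addrA.
Qed.

Let at_dilation p x j : (0 < p)%N -> at_ (D p) x (p%:Z * j) = x j.
Proof. by case: p => // p _; exact: (push_im (@mulSz_inj p)). Qed.

Let at_dilation0 p x k : (0 < p)%N -> ~ (exists j, p%:Z * j = k) -> at_ (D p) x k = 0.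
Proof. by case: p => // p _ nex; exact: (push_notim _ nex). Qed.

Let at_dilation_star p x j : (0 < p)%N -> at_ (star (D p)) x j = x (p%:Z * j).
Proof. by case: p. Qed.

Let at_sum (r : seq nat) (F : nat -> BH) x k :
  at_ (\sum_(i <- r) F i) x k = \sum_(i <- r) at_ (F i) x k.
Proof.
elim: r => [|i r IH]; first by rewrite !big_nil.
by rewrite !big_cons -IH.
Qed.

(** All relations are compared coordinate by coordinate. In the second one, both
    sides map [x] to the vector whose coordinate at [k] is [x j] when
    [p k - m = q j], and [0] when there is no such [j]; the right-hand side detects
    the existence of [j] by divisibility of [k - m1] by [p'], and this is where
    [p'] and [q'] have to be coprime. *)
Lemma representation_relations (P : set nat) :
  (forall p, P p -> (0 < p)%N) ->
  (forall p q p' q', P p -> P q -> P p' -> P q' ->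
     right_ideal P p `&` right_ideal P q = right_ideal P (p * p')%N ->
     (p * p' = q * q')%N -> coprime p' q') ->
  Q_relations P U D.
Proof.
move=> P0 Pcop; split.
- split.
  + split; apply: BH_ext => x k; rewrite atM.
      by rewrite at_shift_star -[LHS]/(at_ _ _ _) at_shift addrK.
    by rewrite at_shift -[LHS]/(at_ _ _ _) at_shift_star subrK.
  + move=> p /P0 p0; apply: BH_ext => x k.
    by rewrite atM at_dilation_star// -[LHS]/(at_ _ _ _) at_dilation.
  + move=> p q /P0 p0 /P0 q0; apply: BH_ext => x k; rewrite atM.
    have pq0 : (0 < p * q)%N by rewrite muln_gt0 p0.
    have [[j <-]|nex] := pselect (exists j : int, p%:Z * j = k); last first.
      rewrite !at_dilation0// => -[j kj]; apply: nex; exists (q%:Z * j).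
      by rewrite mulrA -PoszM.
    rewrite at_dilation// -[LHS]/(at_ _ _ _).
    have [[i <-]|nex] := pselect (exists i : int, q%:Z * i = j).
      by rewrite at_dilation// mulrA -PoszM at_dilation.
    rewrite !at_dilation0// => -[h]; rewrite PoszM -mulrA => pij; apply: nex; exists h.
    by apply: mulfI pij; rewrite eqz_nat -lt0n.
  + by apply: BH_ext => x k; rewrite -{1}(mul1r k) at_dilation.
- move=> p m /P0 p0; apply: BH_ext => x k.
  rewrite !atM at_upow -[RHS]/(at_ _ _ _).
  have [[j <-]|nex] := pselect (exists j : int, p%:Z * j = k).
    by rewrite at_dilation// -mulrBr at_dilation// -[LHS]/(at_ _ _ _) at_upow.
  rewrite !at_dilation0// => -[j kj]; apply: nex; exists (j + m).
  by rewrite mulrDr kj subrK.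
- move=> p q p' q' m m1 m2 Pp Pq Pp' Pq' mE ideal ppqq.
  have cop := Pcop _ _ _ _ Pp Pq Pp' Pq' ideal ppqq.
  have p0 := P0 _ Pp; have q0 := P0 _ Pq; have p'0 := P0 _ Pp'; have q'0 := P0 _ Pq'.
  have ppqqZ : p%:Z * p'%:Z = q%:Z * q'%:Z by rewrite -!PoszM ppqq.
  have pN0 : p%:Z != 0 by rewrite eqz_nat -lt0n.
  have qN0 : q%:Z != 0 by rewrite eqz_nat -lt0n.
  apply: BH_ext => x k; rewrite !atM.
  rewrite at_dilation_star// -[LHS]/(at_ _ _ _) at_upow -[LHS]/(at_ _ _ _).
  rewrite at_upow -[RHS]/(at_ _ _ _).
  have [[j kj]|nex] := pselect (exists j : int, p'%:Z * j = k - m1).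
    rewrite -kj at_dilation// -[RHS]/(at_ _ _ _) at_dilation_star//.
    rewrite -[RHS]/(at_ _ _ _) at_upow.
    have -> : p%:Z * k - m = q%:Z * (q'%:Z * j - m2).
      rewrite mE mulrBr mulrA -ppqqZ -mulrA kj mulrBr opprD addrA.
      by [].
    by rewrite at_dilation.
  rewrite [RHS]at_dilation0//; apply: at_dilation0 => // -[j qj]; apply: nex.
  (* Cancelling the gcd from [p (k - m1) = q (j + m2)] leaves
     [q' (k - m1) = p' (j + m2)], with [p'] and [q'] coprime. *)
  have e1 : p%:Z * (k - m1) = q%:Z * (j + m2) by rewrite mulrBr mulrDr qj mE; ring.
  have e2 : q'%:Z * (k - m1) = p'%:Z * (j + m2).
    apply: (mulfI pN0); rewrite mulrCA e1 [RHS]mulrA ppqqZ; ring.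
  have : (p'%:Z %| k - m1)%Z.
    rewrite -(@Gauss_dvdzr _ q'%:Z) ?coprimezE//.
    by rewrite e2 dvdz_mulr.
  by move=> /dvdzP[i ->]; exists i; rewrite mulrC.
- move=> p q m /P0 p0 /P0 q0 nex; apply: BH_ext => x k; rewrite !atM.
  rewrite at_dilation_star// -[LHS]/(at_ _ _ _) at_upow -[LHS]/(at_ _ _ _).
  rewrite at_dilation0// => -[j qj]; apply: nex; exists k, (- j).
  by rewrite mulrN qj opprB addrC subrK.
- move=> p Pp; have p0 := P0 _ Pp; apply: BH_ext => x k; rewrite at_sum.
  pose k0 := `|(k %% p%:Z)%Z|%N.
  have pN0 : p%:Z != 0 by rewrite eqz_nat -lt0n.
  have k0E : k0%:Z = (k %% p%:Z)%Z by rewrite /k0 gez0_abs// modz_ge0.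
  have k0p : (k0 < p)%N by rewrite -ltz_nat k0E ltz_pmod.
  rewrite (eq_big_nat _ _ (F2 := fun m => if m == k0 then x k else 0)); last first.
    move=> m /andP[_ mp]; rewrite !atM at_upow -[LHS]/(at_ _ _ _).
    case: eqP => [->|mk].
      have -> : k - k0%:Z = p%:Z * (k %/ p%:Z)%Z.
        by rewrite k0E {1}(divz_eq k p%:Z) addrK mulrC.
      rewrite at_dilation// -[LHS]/(at_ _ _ _) at_dilation_star//.
      rewrite -[LHS]/(at_ _ _ _) at_upow opprK k0E [_ * (k %/ _)%Z]mulrC.
      by rewrite -divz_eq.
    rewrite at_dilation0// => -[j pj]; apply: mk.
    have kE : k = j * p%:Z + m%:Z by rewrite mulrC pj subrK.
    by rewrite /k0 kE modzMDl modz_small.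
  by rewrite -big_mkcond /= big_nat1_eq k0p.
Qed.

End RepresentationRelations.

(** * Closures of star-subalgebras *)

(** For products, the second factor is approximated first: the norm of its
    approximant fixes the precision required of the first. *)
Lemma closed_star_subalgebra_approx (R : realType) (A B : cstarType R) (f : A -> B)
    (D : set B) :
  star_morphism f ->
  (forall (a : R[i]) S T, D S -> D T -> D (a *: S + T)) ->
  (forall S T, D S -> D T -> D (S * T)) ->
  (forall T, D T -> D (star T)) ->
  closed_star_subalgebra
    [set x | forall e : R[i], 0 < e -> exists2 T, D T & `|f x - T| <= e].
Proof.
move=> fm Dlin Dmul Dstar; split=> /=.
- apply: closed_of_approx => x apx e e0.
  have [y /= Dy xy] := apx (e / 4) (divr_gt0 e0 (ltr0n _ 4)).
  have [T DT yT] := Dy (e / 2) (divr_gt0 e0 (ltr0n _ 2)).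
  exists T => //; rewrite -(subrKA (f y)) (le_trans (ler_normD _ _))//.
  rewrite [leRHS]splitr lerD// -(starmB fm) (le_trans (starm_norm_le fm _))//.
  rewrite (le_trans (ler_wpM2l _ (ltW xy)))// mulrCA.
  by rewrite ler_pM2l// (natrM _ 2 2) invfM mulrA mulfV ?mul1r// pnatr_eq0.
- move=> a x y Dx Dy e e0.
  have a1 : 0 < `|a| + 1 by rewrite ltr_wpDl.
  have e2 : 0 < e / 2 by rewrite divr_gt0.
  have [S DS xS] := Dx _ (divr_gt0 e2 a1); have [T DT yT] := Dy _ e2.
  exists (a *: S + T); first exact: Dlin.
  rewrite starmD// starmZ// opprD addrACA -scalerBr (le_trans (ler_normD _ _))//.
  rewrite [leRHS]splitr lerD// normrZ (le_trans (ler_wpM2l _ xS))//.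
  by rewrite mulrCA ler_piMr ?(ltW e2)// ler_pdivrMr// mul1r lerDl.
- move=> x y Dx Dy e e0.
  have e2 : 0 < e / 2 by rewrite divr_gt0.
  have x1 : 0 < `|f x| + 1 by rewrite ltr_wpDl.
  have [T DT yT] := Dy _ (divr_gt0 e2 x1).
  have T1 : 0 < `|T| + 1 by rewrite ltr_wpDl.
  have [S DS xS] := Dx _ (divr_gt0 e2 T1).
  exists (S * T); first exact: Dmul.
  have -> : f (x * y) - S * T = f x * (f y - T) + (f x - S) * T.
    by rewrite starmM// mulrBr mulrBl addrA subrK.
  rewrite (le_trans (ler_normD _ _))// [leRHS]splitr lerD//.
    rewrite (le_trans (cnormM _ _))// (le_trans (ler_wpM2l _ yT))//.
    by rewrite mulrCA ler_piMr ?(ltW e2)// ler_pdivrMr// mul1r lerDl.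
  rewrite (le_trans (cnormM _ _))// (le_trans (ler_wpM2r _ xS))//.
  by rewrite mulrAC -mulrA ler_piMr ?(ltW e2)// ler_pdivrMr// mul1r lerDl.
- move=> x Dx e e0; have [T DT xT] := Dx e e0.
  by exists (star T); [exact: Dstar|rewrite starm_star// -starB norm_star].
Qed.

(** * The monoid generated by pairwise coprime numbers *)

Section GeneratedMonoid.
Variable S : set nat.
Let P := generated_submonoid S.

Lemma gen_submonoid1 : P 1%N.
Proof. by move=> M [[]]. Qed.

Lemma gen_submonoidM m n : P m -> P n -> P (m * n)%N.
Proof.
move=> Pm Pn M MS; case: (MS) => [[_ MM] _].
by apply: MM; [exact: Pm MS|exact: Pn MS].
Qed.

Lemma sub_gen_submonoid m : S m -> P m.
Proof. by move=> Sm M [_ SM]; exact: SM. Qed.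

Lemma gen_submonoid_ind (Q : nat -> Prop) :
  Q 1%N -> (forall m n, Q m -> Q n -> Q (m * n)%N) -> (forall m, S m -> Q m) ->
  forall p, P p -> Q p.
Proof. by move=> Q1 QM SQ p Pp; apply: (Pp Q). Qed.

Hypothesis S_gt1 : forall n, S n -> (1 < n)%N.
Hypothesis S_coprime : forall m n, S m -> S n -> m <> n -> coprime m n.

Lemma gen_submonoid_gt0 p : P p -> (0 < p)%N.
Proof.
move: p; apply: (gen_submonoid_ind (Q := fun p => 0 < p)%N) => //.
  by move=> m n m0 n0; rewrite muln_gt0 m0.
by move=> m /S_gt1 /ltnW.
Qed.

(** Generators need not be prime, so a prime divisor of an element of the monoid is
    only known to come from some generator dividing that element within the monoid. *)
Lemma gen_submonoid_prime_divisor p r : P p -> prime r -> (r %| p)%N ->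
  exists t q, [/\ S t, P q, p = (t * q)%N & (r %| t)%N].
Proof.
move=> Pp pr_r.
pose Q p := P p /\ ((r %| p)%N -> exists t q, [/\ S t, P q, p = (t * q)%N & (r %| t)%N]).
suff: Q p by case.
move: p Pp; apply: gen_submonoid_ind => [|m n [Pm IHm] [Pn IHn]|m Sm].
- split; first exact: gen_submonoid1.
  by rewrite dvdn1 => /eqP r1; rewrite r1 in pr_r.
- split; first exact: gen_submonoidM.
  rewrite Euclid_dvdM// => /orP[/IHm|/IHn] [t [q [St Pq -> rt]]].
    exists t, (q * n)%N; split=> //; [exact: gen_submonoidM|by rewrite mulnA].
  exists t, (m * q)%N; split=> //; [exact: gen_submonoidM|by rewrite mulnCA].
- split; first exact: sub_gen_submonoid.
  by exists m, 1%N; split=> //; [exact: gen_submonoid1|rewrite muln1].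
Qed.

(** A common prime of [p'] and [q'] lies in a single generator [t], which can be
    divided out of both: this exhibits an element of [pP] and [qP] that is a proper
    divisor of [pp'], contradicting that [pp'] generates the intersection. *)
Lemma right_lcm_coprime p q p' q' : P p -> P q -> P p' -> P q' ->
  right_ideal P p `&` right_ideal P q = right_ideal P (p * p')%N ->
  (p * p' = q * q')%N -> coprime p' q'.
Proof.
move=> Pp Pq Pp' Pq' ideal ppqq.
have p0 := gen_submonoid_gt0 Pp; have q0 := gen_submonoid_gt0 Pq.
have p'0 := gen_submonoid_gt0 Pp'.
apply: contrapT => /negP ncop.
have g1 : (1 < gcdn p' q')%N.
  by rewrite ltn_neqAle eq_sym ncop gcdn_gt0 p'0.
have pr_r := pdiv_prime g1; have := pdiv_dvd (gcdn p' q').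
rewrite dvdn_gcd => /andP[rp' rq'].
have [t [p2 [St Pp2 p'E rt]]] := gen_submonoid_prime_divisor Pp' pr_r rp'.
have [t' [q2 [St' Pq2 q'E rt']]] := gen_submonoid_prime_divisor Pq' pr_r rq'.
have tt' : t = t'.
  apply: contrapT => /(S_coprime St St') cop.
  have := dvdn_gcd (pdiv (gcdn p' q')) t t'.
  rewrite rt rt' (eqP cop) dvdn1 => /eqP r1.
  by rewrite r1 in pr_r.
have t1 := S_gt1 St; have t0 := ltnW t1.
have pq2 : (p * p2 = q * q2)%N.
  apply/eqP; rewrite -(eqn_pmul2l t0) mulnCA -p'E ppqq q'E -tt' mulnCA.
  by [].
have : (right_ideal P p `&` right_ideal P q) (p * p2)%N.
  by split; [exists p2|exists q2; rewrite ?pq2].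
rewrite ideal => -[z Pz]; rewrite p'E -!mulnA => /eqP.
rewrite (eqn_pmul2l p0) mulnCA -[X in _ == X]muln1 eqn_pmul2l ?gen_submonoid_gt0//.
by rewrite muln_eq1 => /andP[/eqP t_eq1 _]; rewrite t_eq1 in t1.
Qed.

End GeneratedMonoid.

(** * Integer powers of a unitary *)

Section UnitaryPowers.
Variables (R : realType) (A : cstarType R) (u : A).
Hypothesis uu : unitary u.

Lemma upow1 : upow u 1 = u.
Proof. exact: expr1. Qed.

Lemma upowDn (m : int) (n : nat) : upow u (m + n%:Z) = upow u m * u ^+ n.
Proof.
have upowS k : upow u (k + 1) = upow u k * u.
  case: k => k; first by rewrite -PoszD addn1 /= exprSr.
  rewrite /= exprSr -mulrA uu.1 mulr1.
  by case: k => [|k]; rewrite ?expr0// NegzE -addn1 PoszD opprD subrK.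
elim: n => [|n IH]; first by rewrite addr0 expr0 mulr1.
by rewrite intS addrCA (addrC 1) upowS IH exprSr mulrA.
Qed.

Lemma star_upow m : star (upow u m) = upow u (- m).
Proof.
case: m => n /=; last by rewrite starX starK.
by rewrite starX; case: n => [|n]; rewrite ?expr0.
Qed.

Lemma upowKr n : u ^+ n * star u ^+ n = 1.
Proof.
elim: n => [|n IH]; first by rewrite !expr0 mulr1.
by rewrite exprSr exprS -mulrA (mulrA u) uu.2 mul1r.
Qed.

Lemma upowD m n : upow u (m + n) = upow u m * upow u n.
Proof.
case: n => n; first exact: upowDn.
have -> : upow u m = upow u (m - n.+1%:Z) * u ^+ n.+1 by rewrite -upowDn subrK.
by rewrite -mulrA /= upowKr mulr1 NegzE.
Qed.

Lemma unitary_star : unitary (star u).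
Proof. by case: uu => uu1 uu2; split; rewrite starK. Qed.

Lemma upow_starE m : upow (star u) m = upow u (- m).
Proof.
by case: m => n; rewrite -star_upow /= !starX// starK.
Qed.

End UnitaryPowers.

(** * Reflection of the shift and outerness *)

Section Reflection.
Variables (R : realType) (P : set nat) (A : cstarType R) (u : A) (s : nat -> A).
Hypothesis rel : Q_relations P u s.

(** Replacing [u] by [u^*] replaces every exponent by its opposite, which turns each
    of the first relations into another instance of itself; in the summation relation
    [-m] runs through the residues modulo [p] as [m] does. *)
Lemma reflected_relations : Q_relations P (star u) s.
Proof.
case: rel => -[uu sI sM s1] rI rII rII0 rIII; split.
- by split=> //; exact: unitary_star.
- by move=> p m Pp; rewrite !upow_starE// -mulrN rI.
- move=> p q p' q' m m1 m2 Pp Pq Pp' Pq' mE ideal ppqq.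
  rewrite !upow_starE//; apply: rII => //.
  by rewrite mE opprD !mulrN.
- move=> p q m Pp Pq nex; rewrite upow_starE//; apply: rII0 => // -[m1 [m2 mE]].
  apply: nex; exists (- m1), (- m2).
  by rewrite !mulrN -opprD -mE opprK.
- move=> p Pp; pose F (m : int) := upow u m * s p * star (s p) * upow u (- m).
  (* The range projection of [u^m s_p] only depends on [m] modulo [p]. *)
  have F_per m : F (m + p%:Z) = F m.
    have sp : upow u p%:Z * s p = s p * u.
      by rewrite -[in RHS](upow1 u) rI// mulr1.
    have sp' : star (s p) * upow u (- p%:Z) = star u * star (s p).
      by rewrite -star_upow// -!cstarM sp.
    rewrite /F opprD (addrC (- m)) !upowD//.
    rewrite -!mulrA (mulrA (upow u p%:Z)) sp (mulrA (star (s p))) sp'.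
    by rewrite -!mulrA (mulrA u) uu.2 mul1r.
  rewrite -(rIII p Pp).
  transitivity (\sum_(0 <= m < p) F (- m%:Z)).
    by apply: eq_bigr => m _; rewrite /F !upow_starE// opprK.
  have cycle : \sum_(0 <= m < p) F (- (m.+1)%:Z) = \sum_(0 <= m < p) F (- m%:Z).
    apply: (addrI (F 0)).
    transitivity (\sum_(0 <= m < p.+1) F (- m%:Z)).
      by rewrite big_nat_recl.
    by rewrite big_nat_recr//= addrC -(F_per (- p%:Z)) addNr.
  rewrite -cycle [RHS]big_nat_rev /=; apply: eq_big_nat => m /andP[_ mp].
  rewrite add0n -[LHS]F_per -[RHS]/(F (Posz (p - m.+1))); congr F.
  by rewrite addrC subzn.
Qed.

End Reflection.

(** If [w u w^* = u^*], the image of [w] on the square-summable sequences intertwines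
    the bilateral shift with its adjoint, while every element of the algebra is a limit
    of banded operators. *)
Lemma reflecting_automorphism_outer (R : realType) (P : set nat)
    (A : cstarType R) (u : A) (s : nat -> A) :
  (forall p, P p -> (0 < p)%N) ->
  (forall p q p' q', P p -> P q -> P p' -> P q' ->
     right_ideal P p `&` right_ideal P q = right_ideal P (p * p')%N ->
     (p * p' = q * q')%N -> coprime p' q') ->
  is_Q P u s ->
  forall alpha : A -> A, alpha u = star u -> outer alpha.
Proof.
move=> P_gt0 P_cop [rel gen univ] alpha au [w [ww ww'] aw].
have [f [fm fu fs]] := univ _ _ _ (representation_relations R P_gt0 P_cop).
apply: (@no_flip_near_banded R (f w)).
- by rewrite -starm_star// -starmM// ww starm1.
- rewrite -fu -starm_star// -!starmM//; congr (f _).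
  by rewrite -au aw -[RHS]mulrA ww mulr1.
pose D : set (bop (l2_hilbert R int)) := [set T | exists C, banded C T].
have Dlin a S T : D S -> D T -> D (a *: S + T).
  by move=> [C SC] [C' TC]; exists (maxn C C'); exact: banded_lin.
have Dmul (S T : bop (l2_hilbert R int) : cstarType R) : D S -> D T -> D (S * T).
  by move=> [C SC] [C' TC]; exists (C' * (1 + C) + C * (1 + C'))%N; exact: banded_mul.
have Dstar (T : bop (l2_hilbert R int) : cstarType R) : D T -> D (star T).
  by move=> [C TC]; exists C; exact: banded_star.
have closedD := closed_star_subalgebra_approx fm Dlin Dmul Dstar.
have Df x : D (f x) -> forall e : R[i], 0 < e -> exists2 T, D T & `|f x - T| <= e.
  by move=> Dx e e0; exists (f x) => //; rewrite subrr normr0 ltW.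
have Dgen : [set u] `|` s @` P `<=`
    [set x | forall e : R[i], 0 < e -> exists2 T, D T & `|f x - T| <= e].
  move=> x [->|[p Pp <-]]; apply: Df.
    rewrite fu; exists 1%N; apply: banded_index_isometry => n.
    by rewrite /close; case: n => [n|[|n]]; rewrite -?PoszD ?addn1 /=; lia.
  rewrite fs//; have := P_gt0 p Pp; case: p {Pp} => // p _.
  exists p.+1; apply: banded_index_isometry => n.
  rewrite /close; case: n => n; first by rewrite -PoszM /=; split; nia.
  by rewrite NegzE mulrN -PoszM; split; case: (p.+1 * n.+1)%N.
have w_gen : setT w by [].
rewrite -gen in w_gen.
move=> eps eps0; have eps0C : 0 < eps%:C%C by rewrite (ltcR 0).
have [T [C TC] wT] := w_gen _ (conj closedD Dgen) _ eps0C.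
by exists C, T.
Qed.

Theorem theorem6p18 (R : realType) (S : set nat)
    (S_gt1 : forall n, S n -> (1 < n)%N)
    (S_coprime : forall m n, S m -> S n -> m <> n -> coprime m n)
    (P : set nat) (P_def : P = generated_submonoid S)
    (A : cstarType R) (u : A) (s : nat -> A) (A_univ : is_Q P u s) :
  [/\ forall alpha : A -> A,
        star_automorphism alpha -> alpha u = star u -> outer alpha,
      exists2 lambda : A -> A,
        unique (fun f : A -> A =>
          [/\ star_automorphism f, f u = star u
            & forall p, P p -> f (s p) = s p]) lambda
        & outer lambda
    & exists2 phi : A -> A,
        unique (fun f : A -> A =>
          [/\ star_automorphism f, f u = star u
            & forall p, P p -> f (s p) = u ^+ p.-1 * s p]) phi
        & outer phi].
Proof.
have P_gt0 p : P p -> (0 < p)%N by rewrite P_def; exact: gen_submonoid_gt0.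
have P_cop p q p' q' : P p -> P q -> P p' -> P q' ->
    right_ideal P p `&` right_ideal P q = right_ideal P (p * p')%N ->
    (p * p' = q * q')%N -> coprime p' q'.
  by rewrite P_def; exact: right_lcm_coprime.
have all_outer := reflecting_automorphism_outer P_gt0 P_cop A_univ.
case: A_univ => rel gen univ.
have uu : unitary u by case: rel => -[].
have eq_gen (f g : A -> A) : star_morphism f -> star_morphism g -> f u = g u ->
    (forall p, P p -> f (s p) = g (s p)) -> f = g.
  move=> fm gm fu fs; apply/funext; apply: (starm_eq_on_generators gen) => //.
  by move=> x [->//|[p Pp <-]]; exact: fs.
have [lam [lamm lamu lams]] := univ _ _ _ (reflected_relations rel).
have lamK : involutive lam.
  have lam2 : lam \o lam = id.
    apply: eq_gen; [exact: starm_comp|exact: starm_id| |move=> p Pp] => /=.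
      by rewrite lamu starm_star// lamu starK.
    by rewrite !lams.
  by move=> x; rewrite -[RHS]/(id x) -lam2.
split.
- by move=> alpha _; exact: all_outer.
- exists lam; last exact: all_outer.
  split; first by split=> //; split=> //; exists lam.
  move=> g [[gm _] gu gs]; apply: eq_gen => // [|p Pp]; first by rewrite lamu gu.
  by rewrite lams// gs.
(* Conjugation by [u^*] fixes [u^*] and sends [s_p] to [u^(p-1) s_p]. *)
- pose phi x := star u * lam x * u.
  have phim : star_morphism phi.
    split=> [a x y|/=|x]; rewrite /phi.
    + by rewrite starmD// starmZ// mulrDr mulrDl cscaleAr cscaleAl.
    + split=> [|x y]; first by rewrite starm1// mulr1 uu.1.
      rewrite starmM// -!mulrA; congr (_ * (_ * _)).
      by rewrite [RHS]mulrA uu.2 mul1r.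
    + by rewrite starm_star// !cstarM starK mulrA.
  have phiu : phi u = star u by rewrite /phi lamu -mulrA uu.1 mulr1.
  have phis p : P p -> phi (s p) = u ^+ p.-1 * s p.
    move=> Pp; rewrite /phi lams//; case: rel => _ rI _ _ _.
    rewrite -mulrA -[X in s p * X](upow1 u) rI// mulr1.
    have := P_gt0 p Pp; case: p {Pp} => // p _ /=.
    by rewrite exprS !mulrA uu.1 mul1r.
  exists phi; last exact: all_outer.
  split; last first.
    move=> g [[gm _] gu gs]; apply: eq_gen => // [|p Pp]; first by rewrite phiu gu.
    by rewrite phis// gs.
  split=> //; split=> //; exists (fun x => lam (u * x * star u)) => x.
    rewrite /phi !mulrA uu.2 mul1r -mulrA uu.2 mulr1; exact: lamK.
  by rewrite /phi lamK !mulrA uu.1 mul1r -mulrA uu.1 mulr1.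
Qed.
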